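(* For every $\varepsilon>0$ there exists $n_0$ such that every $3$-vertex-divisible $3$-graph $H$ on $n\ge n_0$ vertices with $\delta_2(H)\ge (2/3+\varepsilon)n$ is Eulerian.
   Context: A $3$-graph is a $3$-uniform hypergraph. $\delta_2(H)$ is the minimum, over all pairs of distinct vertices, of the number of edges containing the pair. $H$ is $3$-vertex-divisible if the number of edges containing each vertex is divisible by $3$. A tour in $H$ is a cyclic sequence $v_1,\dots,v_r$ of not necessarily distinct vertices such that for every $1\le i\le r$ the set $\{v_i,v_{i+1},v_{i+2}\}$ (indices modulo $r$) is an edge of $H$, and these $r$ edges are all distinct. $H$ is Eulerian if it contains a tour that covers each edge of $H$ exactly once (an Euler tour). The paper's ''$(2/3+o(1))|H|$'', with $|H|$ the number of vertices, is written out here with $\varepsilon$ and $n_0$. *)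

(* Defs.v *)
From mathcomp Require Import all_boot all_order all_algebra.
From mathcomp Require Import reals.

Set Implicit Arguments.
Unset Strict Implicit.
Unset Printing Implicit Defensive.

Record graph3 (V : finType) := Graph3 {
  edges :> {set {set V}};
  card_edge : forall e : {set V}, e \in edges -> #|e| = 3
}.

Section Defs.
Variable V : finType.
Implicit Type H : graph3 V.

Definition degree H (x : V) : nat := #|[set e in edges H | x \in e]|.

Definition codegree H (x y : V) : nat :=
  #|[set e in edges H | (x \in e) && (y \in e)]|.

(* A codegree is at most #|V| - 2, so the default value #|V| is never the
   minimum once there are two distinct vertices. *)
Definition min_codegree H : nat :=
  \big[minn/#|V|]_(p : V * V | p.1 != p.2) codegree H p.1 p.2.

Definition vertex_divisible3 H : Prop := forall x : V, 3 %| degree H x.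

(* A cyclic sequence v of length r is a function on 'I_r, and ordS is the
   successor modulo r. *)
Definition tour_edge (r : nat) (v : 'I_r -> V) (i : 'I_r) : {set V} :=
  [set v i; v (ordS i); v (ordS (ordS i))].

Definition tour H (r : nat) (v : 'I_r -> V) : Prop :=
  (forall i : 'I_r, tour_edge v i \in edges H) /\ injective (tour_edge v).

Definition euler_tour H (r : nat) (v : 'I_r -> V) : Prop :=
  tour H v /\
  forall e : {set V}, e \in edges H -> exists! i : 'I_r, tour_edge v i = e.

Definition eulerian H : Prop :=
  exists (r : nat) (v : 'I_r -> V), euler_tour H v.

End Defs.

(* Main.v *)
(* Assign to every edge e a middle vertex f e. A tour passing e as (a, b, c) with b = f e enters through the
   pair {a, b} and leaves through {b, c};
     so H splits into tours with these middles iff at every pair {x, y} the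
   edges with middle x are as many as those with middle y, and a longest trail is then an Euler tour as
     soon as
   any two pairs are linked. An edge {x, y, z} with middle z contributes the chain t_z = (z -> x) + (z
     -> y) to
   the antisymmetric function "imbalance", which has to be made zero.
   For uniformly random middles the imbalance is at most a small multiple of n everywhere (Chernoff bounds).
   It is a sum of differences t_z - t_x over triples of the complete 3-graph, each pair lying in few of them:
   its divergence is divisible by 3 and is removed with tokens 3 (x -> y);
     the remaining circulation is a sum of
   permutations (Birkhoff), which are coned off to evenly distributed roots; and tokens cancel in pairs along
   detours, their number being even. Finally a difference t_z - t_x is realised inside H by changing the
   middles of three edges {a, x, y}, {a, y, z}, {a, z, x} whose current middles are a, y, x. Codegree
     above 2n/3
   gives linearly many common neighbours a of the three pairs, so the apexes a can be chosen greedily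
     such that
   no edge is changed twice. *)
Require Import Defs.
From mathcomp Require Import all_boot all_order all_algebra all_fingroup.
From mathcomp Require Import reals zify ring lra.

Set Implicit Arguments.
Unset Strict Implicit.
Unset Printing Implicit Defensive.

Import GRing.Theory Num.Theory Order.TTheory.

(** * Euler tours from balanced middles *)

(** Shifts have two invariants: the divergence of a shift is 3, -3 and 0 at its three vertices, and
    a shift consists of four arcs. So a sum of shifts has all divergences divisible by 3 and an even
    total over the pairs. The imbalance meets the first condition because its divergence at x is
    three times the number of edges with middle x, minus the degree of x; it meets the second
    because every edge contributes two arcs. What shapes the proof is the load on pairs of vertices.
    All auxiliary vertices are chosen greedily, so no pair may be overused, and the decomposition
    multiplies the initial bound by an absolute constant. Hence the initial imbalance must be at
    most n / D with D large in terms of all other constants. The random middles supply this and two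
    more facts: about 1/27 of the common neighbours of a triple carry the right middles for a
    change, and about 1/9 of the common neighbours of two pairs {x, y}, {x', y} link them. Both
    numbers are linear in n and survive the few changes made at each pair. The threshold 2/3 is the
    density above which three sets must meet. *)

Section Euler.
Variables (V : finType) (H : graph3 V) (f : {set V} -> V).

Definition tri (x y z : V) : {set V} := [set x; y; z].

Lemma tri_swap x y z : tri y x z = tri x y z.
Proof. by apply/setP=> w; rewrite !inE (orbC (w == y)). Qed.

Lemma tri_rot x y z : tri y z x = tri x y z.
Proof. by apply/setP=> w; rewrite !inE orbC orbA. Qed.

Lemma tri_rev x y z : tri z y x = tri x y z.
Proof. by rewrite tri_swap tri_rot. Qed.

Lemma card_tri x y z : #|tri x y z| = 3 -> [/\ x != y, y != z & x != z].
Proof.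
rewrite /tri setUC cardsU1 cards2 !inE negb_or.
by rewrite (eq_sym z) (eq_sym z); case: (x == y); case: (x == z); case: (y == z).
Qed.

Lemma triP (e : {set V}) x y : #|e| = 3 -> x \in e -> y \in e -> x != y ->
  exists z, e = tri x y z.
Proof.
move=> e3 xe ye xy.
have : #|e :\ x :\ y| = 1.
  by apply: succn_inj; apply: succn_inj;
    rewrite -[RHS]e3 (cardsD1 x e) xe (cardsD1 y (e :\ x)) !inE ye eq_sym xy.
move/eqP/cards1P=> [z ez]; exists z; apply/setP=> w; move/setP/(_ w): ez; rewrite !inE.
by case: (w =P x) => [->|_] /=; rewrite ?xe //; case: (w =P y) => [->|_] //=.
Qed.

(* A triple (x, y, z) traverses the edge {x, y, z} from the pair (x, y) to the pair (y, z). *)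
Let T := (V * V * V)%type.
Definition hyperedge (t : T) := tri t.1.1 t.1.2 t.2.
Definition follows (t u : T) := (t.1.2 == u.1.1) && (t.2 == u.1.2).
Definition traversal (t : T) := (hyperedge t \in edges H) && (f (hyperedge t) == t.1.2).
Definition trail (s : seq T) := all traversal s && uniq (map hyperedge s).

Definition mid_count x y := #|[set e in edges H | [&& x \in e, y \in e & f e == x]]|.

Lemma traversal_neq t : traversal t -> [/\ t.1.1 != t.1.2, t.1.2 != t.2 & t.1.1 != t.2].
Proof. by case/andP=> /card_edge/card_tri. Qed.

Lemma size_trail s : trail s -> size s <= #|edges H|.
Proof.
case/andP=> /allP As Us; rewrite -(size_map hyperedge) cardE; apply: uniq_leq_size => // e.
by case/mapP=> t /As/andP[te _] ->; rewrite mem_enum.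
Qed.

Definition exits p q := fun t : T => (t.1.1 == p) && (t.1.2 == q).
Definition enters p q := fun t : T => (t.1.2 == p) && (t.2 == q).

(** An entry into the ordered pair (p, q) is followed at once by an exit from it, so only the two
    ends of the walk can make the counts differ. *)
Lemma enters_exits_path p q t s : path follows t s ->
  count (enters p q) (t :: s) + exits p q t = count (exits p q) (t :: s) + enters p q (last t s).
Proof.
elim: s t => [|u s IH] t /=; first by rewrite !addn0 addnC.
case/andP=> /andP[/eqP a /eqP b] /IH /= E.
have -> : enters p q t = exits p q u by rewrite /enters /exits a b.
lia.
Qed.

Lemma card_set_count (A : finType) (s : seq A) (P : pred A) :
  uniq s -> #|[set e in s | P e]| = count P s.
Proof.
move=> us; rewrite -size_filter -(card_uniqP (filter_uniq P us)).
by apply: eq_card => e; rewrite !inE mem_filter andbC.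
Qed.

(** A traversal with middle q through p starts with (p, q) or ends with (q, p), and not both, its
    vertices being distinct. This turns counts along the walk into counts of edges by middle, to
    which balance applies. *)
Lemma count_used_mid s p q : trail s -> p != q ->
  count (exits p q) s + count (enters q p) s =
  #|[set e in map hyperedge s | [&& p \in e, q \in e & f e == q]]|.
Proof.
case/andP=> As Us pq.
rewrite card_set_count //.
rewrite count_map -count_predUI addnC.
have -> : count (predI (exits p q) (enters q p)) s = 0.
  apply/eqP; rewrite -leqn0 leqNgt -has_count; apply/hasPn => t ts /=.
  have [_ _ n] := traversal_neq (allP As _ ts).
  by apply/negP=> /andP[/andP[/eqP a _] /andP[_ /eqP b]]; rewrite a b eqxx in n.
rewrite add0n; apply: eq_in_count => -[[a b] c] ts /=.
have /andP[_ /eqP fm] := allP As _ ts; have [/= ab bc ac] := traversal_neq (allP As _ ts).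
rewrite fm /exits /enters /hyperedge /tri /= !inE.
case: (b =P q) => [bq|_] /=; last by rewrite !andbF.
subst q; rewrite eqxx !orbT !andbT /= (negbTE pq) orbF.
by rewrite (eq_sym p a) (eq_sym p c).
Qed.

Hypothesis mid_in : forall e, e \in edges H -> f e \in e.
Hypothesis balanced : forall x y, x != y -> mid_count x y = mid_count y x.

Lemma unused_mid s p q : trail s ->
  #|[set e in map hyperedge s | [&& p \in e, q \in e & f e == q]]| < mid_count q p ->
  exists e, [/\ e \in edges H, e \notin map hyperedge s, p \in e, q \in e & f e = q].
Proof.
move=> /andP[/allP As _]; rewrite /mid_count.
set A := [set e in map _ _ | _]; set B := [set e in _ | _] => lt.
have : ~~ (B \subset A) by apply/negP=> /subset_leq_card; rewrite leqNgt lt.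
case/subsetPn=> e; rewrite !inE => /and4P[eH qe pe /eqP fe]; rewrite pe qe fe eqxx /= andbT => eu.
by exists e.
Qed.

Lemma mid_traversal e p q : e \in edges H -> p \in e -> q \in e -> p != q -> f e = q ->
  exists w, [/\ e = hyperedge (p, q, w), e = hyperedge (w, q, p),
    traversal (p, q, w) & traversal (w, q, p)].
Proof.
move=> eH pe qe pq fe; have [w ew] := triP (card_edge eH) pe qe pq.
exists w; rewrite /traversal /hyperedge /= (tri_rev p q w) -ew eH fe eqxx.
by split.
Qed.

Definition walk s := trail s && sorted follows s.

Lemma walk_prepend p q t s e : walk (t :: s) -> exits q p t ->
  e \in edges H -> e \notin map hyperedge (t :: s) -> p \in e -> q \in e -> p != q ->
  f e = q -> exists u, walk (u :: t :: s).
Proof.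
move=> /andP[/andP[As Us] ps] /andP[/eqP tq /eqP tp] eH eu pe qe pq fe.
have [w [_ ew _ tw]] := mid_traversal eH pe qe pq fe.
exists (w, q, p); rewrite /walk /trail /sorted /= in As Us ps eu *.
by rewrite tw As -ew eu Us /follows /= tq tp !eqxx.
Qed.

Lemma walk_append p q s t e : walk (rcons s t) -> enters p q t ->
  e \in edges H -> e \notin map hyperedge (rcons s t) -> p \in e -> q \in e -> p != q ->
  f e = q -> exists u, walk (rcons (rcons s t) u).
Proof.
move=> /andP[/andP[As Us] ps] /andP[/eqP tp /eqP tq] eH eu pe qe pq fe.
have [w [ew _ tw _]] := mid_traversal eH pe qe pq fe.
exists (p, q, w); rewrite /walk /trail map_rcons rcons_uniq -ew eu Us all_rcons tw As /=.
case: s As Us eu ps => [|a s] /= _ _ _ ps; first by rewrite /follows /= tp tq !eqxx.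
by rewrite rcons_path ps last_rcons /follows /= tp tq !eqxx.
Qed.

Lemma maximal_walk s : walk s ->
  exists2 m, walk m & forall s', walk s' -> size s' <= size m.
Proof.
move=> ws.
(* With the length fixed, walks are tuples over a finite type, so their existence is a boolean
   predicate. *)
pose P n := [exists t : n.-tuple T, walk t].
have bP n : P n -> n <= #|edges H|.
  by case/existsP=> t /andP[/size_trail]; rewrite size_tuple.
have wP s' : walk s' -> P (size s').
  by move=> w; apply/existsP; exists (in_tuple s').
have [n /existsP[t wt] mx] := ex_maxnP (ex_intro P _ (wP s ws)) bP.
by exists t => // s' /wP /mx; rewrite size_tuple.
Qed.

(* A trail that ends at (y, z) without closing up has used more edges at {y, z} with middle y than with
   middle z, so by balance there is an unused edge to continue with. *)
Lemma maximal_walk_cycle t s :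
  walk (t :: s) -> (forall s', walk s' -> size s' <= size (t :: s)) -> follows (last t s) t.
Proof.
move=> ws mx; apply/negPn/negP => nf.
have /andP[ts ps] := ws.
set l := last t s in nf; pose y := l.1.2; pose z := l.2.
have tl : traversal l by case/andP: ts => /allP /(_ l (mem_last t s)).
have [_ yz _] := traversal_neq tl; rewrite -/y -/z in yz.
have zy : z != y by rewrite eq_sym.
have := enters_exits_path y z ps; have := enters_exits_path z y ps.
have -> : exits y z t = false.
  by apply/negP; move: nf; rewrite /follows /exits ![_ == t.1.1]eq_sym ![_ == t.1.2]eq_sym => /negP.
have -> : enters z y (last t s) = false by rewrite /enters -/l -/y (negbTE yz).
have -> : enters y z (last t s) by rewrite /enters -/l !eqxx.
have cy := count_used_mid ts zy; have cz := count_used_mid ts yz.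
have := unused_mid (s := t :: s) (p := y) (q := z) ts.
have le : #|[set e in map hyperedge (t :: s) | [&& z \in e, y \in e & f e == y]]| <= mid_count y z.
  apply/subset_leq_card/subsetP=> e; rewrite !in_set => /andP[/mapP[u us ->] /and3P[-> -> ->]].
  by case/andP: ts => /allP /(_ u us) /andP[-> _].
rewrite -cz -balanced // => H1 E1 E2.
have [e [eH eu ye ze fe]] : exists e, [/\ e \in edges H, e \notin map hyperedge (t :: s), y \in e, z
  \in e & f e = z].
  apply: H1; apply: leq_trans le; rewrite -cy; move: E1 E2 => /=; lia.
have el : enters y z l by rewrite /enters !eqxx.
have rs : t :: s = rcons (belast t s) l by rewrite -lastI.
rewrite rs in ws eu mx.
have [u /mx] := walk_append ws el eH eu ye ze yz fe.
by rewrite size_rcons ltnn.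
Qed.

Hypothesis linked : forall x x' y, x != y -> x' != y -> x != x' ->
  exists z, [/\ tri x y z \in edges H, tri x' y z \in edges H,
    f (tri x y z) = y & f (tri x' y z) = y].

(** * Closed walks of maximal length *)

Section MaximalWalk.
Variable s : seq T.
Hypotheses (ws : walk s) (cs : path.cycle follows s) (mx : forall s', walk s' -> size s' <= size s).

Lemma rotate_to t : t \in s ->
  exists2 p, perm_eq (t :: p) s & path follows t (rcons p t).
Proof.
move=> ts; have [i p E] := rot_to ts; exists p.
  by rewrite -E perm_rot.
by have := cs; rewrite -(rot_cycle i) E.
Qed.

Lemma perm_trail s1 : perm_eq s1 s -> trail s1.
Proof.
move=> pe; case/andP: ws => /andP[As Us] _.
by rewrite /trail (perm_all _ pe) As (perm_uniq (perm_map hyperedge pe)).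
Qed.

(** A used edge is passed through the two pairs that contain its middle, but not through the third
    pair; hence the condition on the middle. Next to such a traversal the closed walk can be cut at
    the pair. *)
Definition touched x y := exists t, [/\ t \in s, x \in hyperedge t, y \in hyperedge t
  & (f (hyperedge t) == x) || (f (hyperedge t) == y)].

Lemma touched_sym x y : touched x y -> touched y x.
Proof. by case=> t [? ? ?]; rewrite orbC => ?; exists t. Qed.

Lemma touched_used_aux x y e : touched x y -> x != y -> e \in edges H ->
  x \in e -> y \in e -> f e = y -> e \in map hyperedge s.
Proof.
move=> [t [ts xt yt mt]] xy eH xe ye fe; apply/negPn/negP => eu.
have [p pt] := rotate_to ts; rewrite rcons_path => /andP[pp lt].
have w1 : walk (t :: p) by rewrite /walk perm_trail.
have pr : perm_eq (rcons p t) s by rewrite perm_rcons.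
have w2 : walk (rcons p t).
  rewrite /walk perm_trail //=; case: {pt w1 pr} p pp lt => [|u p] //= /andP[_ pp] lt.
  by rewrite rcons_path pp.
have n1 : e \notin map hyperedge (t :: p) by rewrite (perm_mem (perm_map hyperedge pt)).
have n2 : e \notin map hyperedge (rcons p t) by rewrite (perm_mem (perm_map hyperedge pr)).
have s1 : size (t :: p) = size s by apply: perm_size.
have s2 : size (rcons p t) = size s by apply: perm_size.
(* The four ways in which [t] can meet the pair. The end that is extended is [t] itself in [A1] and
   [A2], its predecessor in [A3] and its successor in [A4]. *)
have A1 : exits y x t -> False.
  by move=> ex; have [u /mx] := walk_prepend w1 ex eH n1 xe ye xy fe; rewrite /= -s1 /= ltnn.
have A2 : enters x y t -> False.
  by move=> ex; have [u /mx] := walk_append w2 ex eH n2 xe ye xy fe; rewrite size_rcons s2 ltnn.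
have A3 : exits x y t -> False.
  move=> /andP[/eqP tx /eqP ty]; move: w1 n1 s1; rewrite lastI => w1 n1 s1.
  have ex : enters x y (last t p) by move: lt; rewrite /follows /enters tx ty.
  by have [u /mx] := walk_append w1 ex eH n1 xe ye xy fe; rewrite size_rcons s1 ltnn.
have A4 : enters y x t -> False.
  move=> /andP[/eqP tx /eqP ty]; case: p pp lt w2 n2 s2 {pt w1 pr n1 s1} => [|u p].
    by move=> _ /andP[/eqP a /eqP b] _ _ _; apply: A1; apply/andP; split; apply/eqP;
      [rewrite -a | rewrite -b].
  rewrite [path _ _ _]/= => /andP[/andP[/eqP a /eqP b] _] _; rewrite rcons_cons => w2 n2 s2.
  have ex : exits y x u by rewrite /exits -a -b tx ty !eqxx.
  by have [v /mx] := walk_prepend w2 ex eH n2 xe ye xy fe; rewrite /= -s2 /= ltnn.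
case/andP: (perm_trail pt) => /andP[tt _] _.
have [ab bc ac] := traversal_neq tt.
case/andP: tt => _ /eqP ft; move: xt yt mt; rewrite ft /hyperedge /tri !inE.
move: A1 A2 A3 A4 ab bc ac; rewrite /exits /enters.
case: t {ts pt pp lt w1 pr w2 n1 n2 s1 s2 ft} => [[a b] c] /= A1 A2 A3 A4 ab bc ac.
rewrite (eq_sym x a) (eq_sym y a) (eq_sym x b) (eq_sym y b) (eq_sym x c) (eq_sym y c).
move=> xt yt /orP[/eqP E|/eqP E]; subst b.
  move: A1 A2 yt; rewrite eqxx (negbTE xy) !andbT /= orbF => A1 A2 /orP[|] //.
move: A3 A4 xt; rewrite eqxx (eq_sym y x) (negbTE xy) !andbT /= orbF => A3 A4 /orP[|] //.
Qed.

Lemma touched_used x y e : touched x y -> x != y -> e \in edges H ->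
  x \in e -> y \in e -> (f e == x) || (f e == y) -> e \in map hyperedge s.
Proof.
move=> txy xy eH xe ye /orP[/eqP|/eqP] fe; last exact: (touched_used_aux txy).
by apply: (touched_used_aux (touched_sym txy)); rewrite // eq_sym.
Qed.

(** The link z carries the property over: {x, y, z} has middle y and is therefore used, which
    touches {y, z}; then {x', y, z} is used as well and touches {x', y}. *)
Lemma touched_step x x' y : touched x y -> x != y -> x' != y -> touched x' y.
Proof.
move=> txy xy x'y; have [<- //|xx'] := eqVneq x x'.
have [z [e1 e2 f1 f2]] := linked xy x'y xx'.
have [_ yz _] := card_tri (card_edge e1).
have : tri x y z \in map hyperedge s.
  by apply: (touched_used txy) => //; rewrite ?f1 ?eqxx ?orbT // !inE eqxx ?orbT.
case/mapP=> t ts te.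
have tyz : touched y z.
  by exists t; rewrite -te f1 eqxx !inE !eqxx !orbT.
have : tri x' y z \in map hyperedge s.
  by apply: (touched_used tyz) => //; rewrite ?f2 ?eqxx ?orbT // !inE eqxx ?orbT.
case/mapP=> u us ue; exists u; rewrite -ue f2 eqxx !inE !eqxx !orbT.
by split.
Qed.

Lemma maximal_walk_covers e : s != [::] -> e \in edges H -> e \in map hyperedge s.
Proof.
case Es : s => [|t s'] // _ eH; rewrite -Es.
have ts : t \in s by rewrite Es mem_head.
have tt : traversal t by case/andP: ws => /andP[/allP A _] _; apply: A.
have [ab _ _] := traversal_neq tt.
have tab : touched t.1.1 t.1.2.
  by exists t; case/andP: tt => _ /eqP ->; rewrite !inE !eqxx !orbT.
(* Each step replaces one vertex of the pair, so two steps reach every pair. *)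
have all2 x y : x != y -> touched x y.
  move=> xy; have [ya|ya] := eqVneq y t.1.1.
    rewrite ya in xy *; apply: touched_step (touched_sym tab) _ xy; by rewrite eq_sym.
  by apply: touched_step (touched_sym (touched_step (touched_sym tab) _ ya)) _ xy;
     rewrite eq_sym.
have fe := mid_in eH.
have /set0Pn[w] : e :\ f e != set0.
  by rewrite -card_gt0; have := cardsD1 (f e) e; rewrite fe (card_edge eH); lia.
rewrite !inE => /andP[wf we].
by apply: (touched_used (all2 _ _ wf)); rewrite ?eqxx ?orbT.
Qed.

Lemma closed_walk_euler_tour :
  (forall e, e \in edges H -> e \in map hyperedge s) -> eulerian H.
Proof.
move=> cov; case Es : s => [|t s'].
  (* An empty walk covers only an edgeless hypergraph, whose Euler tour has length 0. *)
  exists 0, (fun i : 'I_0 => match i with Ordinal _ lt => match notF lt with end end).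
  split; first by split; [case | case].
  by move=> e /cov; rewrite Es.
exists (size s), (fun i : 'I_(size s) => (nth t s i).1.1).
have step i : i < size s -> follows (nth t s i) (nth t s (i.+1 %% size s)).
  move: cs; rewrite Es /path.cycle => /pathP => /(_ t) cs' lt.
  have := cs' i; rewrite size_rcons => /(_ lt).
  have -> : nth t (t :: rcons s' t) i = nth t (t :: s') i.
    by rewrite -rcons_cons nth_rcons lt.
  rewrite nth_rcons; move: lt; rewrite ltnS leq_eqVlt => /orP[/eqP ->|lt].
    by rewrite ltnn eqxx modnn.
  by rewrite lt modn_small.
have TE (i : 'I_(size s)) : tour_edge (fun i : 'I_(size s) => (nth t s i).1.1) i = hyperedge (nth t s i).
  rewrite /tour_edge /=; have /andP[/eqP a /eqP b] := step i (ltn_ord i).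
  have /andP[/eqP c /eqP d] := step _ (ltn_ord (ordS i)).
  by rewrite -c -a /= -b.
case/andP: ws => /andP[As Us] _.
have inj : injective (tour_edge (fun i : 'I_(size s) => (nth t s i).1.1)).
  move=> i j; rewrite !TE => E; apply/val_inj/eqP => /=.
  rewrite -(nth_uniq (hyperedge t) _ _ Us) ?size_map //.
  by rewrite !(nth_map t) ?E.
split; first split => // i.
  by rewrite TE; have /andP[] := allP As _ (mem_nth t (ltn_ord i)).
move=> e /cov /mapP[u /(nthP t)[i lt <-] ->].
exists (Ordinal lt); split; first by rewrite TE.
by move=> j E; apply: inj; rewrite E TE.
Qed.
End MaximalWalk.

Lemma balanced_eulerian : eulerian H.
Proof.
have [E0|[e0 e0H]] := set_0Vmem (edges H).
  apply: (@closed_walk_euler_tour [::]) => // e.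
  by rewrite E0 inE.
have fe := mid_in e0H.
have /set0Pn[w] : e0 :\ f e0 != set0.
  by rewrite -card_gt0; have := cardsD1 (f e0) e0; rewrite fe (card_edge e0H); lia.
rewrite !inE => /andP[wf we].
have [z [_ _ t1 _]] := mid_traversal e0H we fe wf erefl.
have w1 : walk [:: (w, f e0, z)] by rewrite /walk /trail /= t1.
have [m wm mx] := maximal_walk w1.
have := mx _ w1; case: m wm mx => // t s wm mx _.
have cm : path.cycle follows (t :: s).
  by rewrite /= rcons_path (maximal_walk_cycle wm mx) andbT; case/andP: wm.
apply: (closed_walk_euler_tour wm cm) => e.
exact: (maximal_walk_covers wm cm mx).
Qed.
End Euler.

(** * Hall's theorem and permutation decompositions *)

Section Hall.
Variables (X Y : finType).

Definition nbhd (N : X -> {set Y}) (S : {set X}) := \bigcup_(x in S) N x.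

(** Induction on the size of [A], after Halmos and Vaughan. If some nonempty proper subset S is
    tight, S and its complement are matched separately, the latter outside the neighbourhood of S.
    If none is, all these subsets have a neighbour to spare, and one x may take any y. Values are
    options because [Y] need not have a default element. *)
Lemma hall (A : {set X}) (N : X -> {set Y}) :
  (forall S : {set X}, S \subset A -> #|S| <= #|nbhd N S|) ->
  exists2 g : X -> option Y, {in A &, injective g} & forall x, x \in A -> exists2 y, y \in N x & g x = Some y.
Proof.
have [n] := ubnP #|A|; elim: n A N => // n IH A N; rewrite ltnS => leA hallN.
have [->|[x xA]] := set_0Vmem A.
  by exists (fun=> None) => // x; rewrite inE.
have [/existsP[S /and4P[SA S0 SnA tight]]|] :=
  boolP [exists S : {set X}, [&& S \subset A, S != set0, S != A & #|nbhd N S| <= #|S|]].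
- have SpA : S \proper A by rewrite properEneq SnA.
  have ltS : #|S| < n := leq_trans (proper_card SpA) leA.
  have [g1 inj1 g1P] := IH S N ltS (fun U US => hallN U (subset_trans US SA)).
  have ltD : #|A :\: S| < n.
    rewrite cardsD (setIidPr SA); move: S0; rewrite -card_gt0; have := subset_leq_card SA; lia.
  have [|g2 inj2 g2P] := IH (A :\: S) (fun x => N x :\: nbhd N S) ltD.
    move=> U UD.
    have dSU : [disjoint S & U].
      by rewrite disjoint_sym; apply: disjointWl UD _;
        rewrite -setI_eq0 setDE -setIA (setIC _ S) setICr setI0.
    have := hallN (S :|: U).
    rewrite subUset SA (subset_trans UD (subsetDl _ _)) => /(_ isT).
    have -> : nbhd N (S :|: U) = nbhd N S :|: nbhd (fun x => N x :\: nbhd N S) U.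
      apply/setP=> y; rewrite inE /nbhd; apply/bigcupP/orP.
        case=> z; rewrite inE => /orP[zS|zU] yz; first by left; apply/bigcupP; exists z.
        have [?|ny] := boolP (y \in \bigcup_(x in S) N x); [by left|right].
        by apply/bigcupP; exists z => //; rewrite inE ny.
      case=> /bigcupP[z zS]; first by exists z; rewrite // inE zS.
      by rewrite inE => /andP[_ yz]; exists z; rewrite // inE zS orbT.
    rewrite !cardsU (eqP (_ : S :&: U == set0)) ?setI_eq0 // cards0; lia.
  exists (fun x => if x \in S then g1 x else g2 x).
    move=> u v uA vA; case: ifP => uS; case: ifP => vS; first exact: inj1.
    - have [y yu ->] := g1P u uS; have [|z zv ->] := g2P v; first by rewrite inE vS.
      move=> [E]; move: zv; rewrite inE -E => /andP[/negP[]].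
      by apply/bigcupP; exists u.
    - have [y yu ->] := g1P v vS; have [|z zv ->] := g2P u; first by rewrite inE uS.
      move=> [E]; move: zv; rewrite inE E => /andP[/negP[]].
      by apply/bigcupP; exists v.
    - by apply: inj2; rewrite inE ?uS ?vS.
  move=> u uA; case: ifP => uS; first exact: g1P.
  have [|y yu ->] := g2P u; first by rewrite inE uS.
  by exists y => //; move: yu; rewrite inE => /andP[].
- rewrite negb_exists => /forallP slack.
  have /set0Pn[y yx] : N x != set0.
    have := hallN [set x]; rewrite sub1set xA => /(_ isT).
    by rewrite cards1 /nbhd big_set1 card_gt0.
  have ltA : #|A :\ x| < n by move: leA; rewrite (cardsD1 x A) xA.
  have [|g injg gP] := IH (A :\ x) (fun u => N u :\ y) ltA.
    move=> U UA; have [->|U0] := eqVneq U set0; first by rewrite cards0.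
    have UsA : U \subset A := subset_trans UA (subsetDl _ _).
    have UnA : U != A by apply: contraTneq xA => <-; apply/negP=> /(subsetP UA); rewrite !inE eqxx.
    have := slack U; rewrite UsA U0 UnA /= -ltnNge => lt.
    have -> : nbhd (fun u => N u :\ y) U = nbhd N U :\ y.
      apply/setP=> z; rewrite !inE /nbhd; apply/bigcupP/andP.
        by case=> u uU; rewrite !inE => /andP[zy zu]; split=> //; apply/bigcupP; exists u.
      by case=> zy /bigcupP[u uU zu]; exists u; rewrite // !inE zy.
    by move: lt; rewrite (cardsD1 y (nbhd N U)); case: (y \in _); lia.
  exists (fun u => if u == x then Some y else g u).
    move=> u v uA vA; case: (u =P x) => [->|/eqP ux]; case: (v =P x) => [-> //|/eqP vx].
    - have [|z zv ->] := gP v; first by rewrite !inE vx.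
      by move=> [E]; move: zv; rewrite !inE E eqxx.
    - have [|z zv ->] := gP u; first by rewrite !inE ux.
      by move=> [E]; move: zv; rewrite !inE E eqxx.
    - by apply: injg; rewrite !inE ?ux ?vx.
  move=> u uA; case: (u =P x) => [->|/eqP ux]; first by exists y.
  have [|z zu ->] := gP u; first by rewrite !inE ux.
  by exists z => //; move: zu; rewrite !inE => /andP[].
Qed.
End Hall.

Section Birkhoff.
Variable V : finType.

(** Hall's condition for the support of [A]: the rows of S have total weight d |S|, all of it in the
    columns of the neighbourhood, whose total weight is d times their number. *)
Lemma regular_perm (A : V -> V -> nat) d : 0 < d ->
  (forall x, \sum_y A x y = d) -> (forall y, \sum_x A x y = d) ->
  exists s : {perm V}, forall x, 0 < A x (s x).
Proof.
move=> d0 row col.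
have [|g injg gP] := @hall V V setT (fun x => [set y | 0 < A x y]).
  move=> S _; rewrite -(leq_pmul2l d0) -[leqLHS]mulnC -[leqRHS]mulnC -!sum_nat_const.
  set N := nbhd _ _.
  have -> : \sum_(x in S) d = \sum_(x in S) \sum_(y in N) A x y.
    apply: eq_bigr => x xS; rewrite -(row x) (bigID (mem N)) /= [X in _ + X]big1 ?addn0 // => y yN.
    apply/eqP; rewrite -leqn0 leqNgt; apply/negP=> Axy; case/negP: yN.
    by apply/bigcupP; exists x; rewrite // inE.
  rewrite exchange_big; apply: leq_sum => y _; rewrite -(col y).
  by rewrite [leqRHS](bigID (mem S)) leq_addr.
pose h x := odflt x (g x).
have hP x : g x = Some (h x) /\ 0 < A x (h x).
  by have [y] := gP x (in_setT x); rewrite /h inE => Ay ->.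
have injh : injective h.
  by move=> x y E; apply: injg; rewrite ?inE //; case: (hP x) => -> _; case: (hP y) => -> _; rewrite E.
by exists (perm injh) => x; rewrite permE; case: (hP x).
Qed.

(** Subtracting one permutation inside the support lowers every row and column sum by one. *)
Lemma birkhoff d (A : V -> V -> nat) :
  (forall x, \sum_y A x y = d) -> (forall y, \sum_x A x y = d) ->
  exists2 ps : seq {perm V}, size ps = d &
    forall x y, A x y = count (fun s : {perm V} => s x == y) ps.
Proof.
elim: d A => [|d IH] A row col.
  exists [::] => // x y; apply/eqP; have /eqP := row x.
  by rewrite sum_nat_eq0 => /forallP/(_ y).
have [//|s sP] := regular_perm _ row col.
have AE x y : A x y = (s x == y) + (A x y - (s x == y)).
  by case: eqP => [<-|_]; [have := sP x; lia | lia].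
have [x|y|ps sz cP] := IH (fun x y => A x y - (s x == y)).
- have := row x; rewrite (eq_bigr _ (fun y _ => AE x y)) big_split /=.
  rewrite (bigD1 (s x)) //= eqxx big1 => [|y]; first by lia.
  by rewrite eq_sym => /negbTE ->.
- have := col y; rewrite (eq_bigr _ (fun x _ => AE x y)) big_split /=.
  rewrite (bigD1 ((s^-1)%g y)) //= permKV eqxx big1 => [|x]; first by lia.
  by move=> /negbTE nx; apply/eqP; rewrite eqb0; apply: contraFN nx => /eqP <-; rewrite permK.
exists (s :: ps); first by rewrite /= sz.
by move=> x y; rewrite /= -cP -AE.
Qed.
End Birkhoff.

(** * Decomposing an imbalance into shifts *)

Section Greedy.
Variable V : finType.

Lemma sum_count_eq (T : Type) (s : seq T) (P : pred T) (g : T -> V) :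
  \sum_w count (fun x => P x && (g x == w)) s = count P s.
Proof.
elim: s => [|x s IH] /=; first by rewrite big1.
rewrite big_split /= IH; congr (_ + _); rewrite (bigD1 (g x)) //= eqxx andbT big1 ?addn0 //.
by move=> w; rewrite eq_sym => /negbTE ->; rewrite andbF.
Qed.

Lemma card_overloaded (T : Type) (s : seq T) (P : pred T) (g : T -> V) L r :
  0 < L -> count P s <= L * r ->
  #|[set w | L <= count (fun x => P x && (g x == w)) s]| <= r.
Proof.
move=> L0 le; rewrite -(leq_pmul2l L0) (leq_trans _ le) // -(sum_count_eq s P g).
rewrite mulnC -sum_nat_const [leqRHS](bigID (mem [set w | L <= count (fun x => P x && (g x == w)) s])) /=.
by apply: leq_trans (leq_addr _ _); apply: leq_sum => w; rewrite inE.
Qed.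

Lemma card_bigcup_leq (s : seq V) (F : V -> {set V}) r :
  (forall x, x \in s -> #|F x| <= r) -> #|\bigcup_(x <- s) F x| <= size s * r.
Proof.
elim: s => [|x s IH] H; first by rewrite big_nil cards0.
rewrite big_cons; apply: leq_trans (leq_card_setU _ _) _; rewrite mulSn leq_add ?H ?mem_head //.
by apply: IH => y ys; rewrite H // inE ys orbT.
Qed.

Lemma set_avoid (S : {set V}) : #|S| < #|V| -> exists w, w \notin S.
Proof.
move=> lt; have /set0Pn[w] : ~: S != set0 by rewrite -card_gt0 cardsCs setCK subn_gt0.
by rewrite inE; exists w.
Qed.

(** Forbidden for an item [t] are its at most [k] base vertices; for each of these, at most [r]
    vertices already chosen [L] times together with it (from [D <= L * r]); and at most [q] vertices
    already chosen [M] times. Fewer than [#|V|] vertices are forbidden altogether. *)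
Lemma greedy_vertex (T : eqType) (base : T -> seq V) (ts : seq T) k D L r M q :
  (forall t, t \in ts -> size (base t) <= k) ->
  (forall v, count (fun t => v \in base t) ts <= D) ->
  0 < L -> D <= L * r -> 0 < M -> size ts <= M * q -> k * r + q + k < #|V| ->
  exists zs : seq (T * V), [/\ map fst zs = ts, all (fun z => z.2 \notin base z.1) zs,
    (forall v w, count (fun z => (v \in base z.1) && (z.2 == w)) zs <= L) &
    (forall w, count (fun z => z.2 == w) zs <= M)].
Proof.
move=> sz dg L0 DL M0 NM lt.
elim: ts sz dg NM => [|t ts IH] sz dg NM.
  by exists [::]; split.
have [|v||zs [zE az l1 l2]] := IH.
- by move=> u us; apply: sz; rewrite inE us orbT.
- by apply: leq_trans (dg v); rewrite leq_addl.
- exact: leq_trans NM.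
have cz P : count (fun z : T * V => P z.1) zs = count P ts by rewrite -zE count_map.
have bt : size (base t) <= k by apply: sz; rewrite mem_head.
pose S1 := [set w in base t].
pose S2 := \bigcup_(v <- base t) [set w | L <= count (fun z => (v \in base z.1) && (z.2 == w)) zs].
pose S3 := [set w | M <= count (fun z => predT z && (z.2 == w)) zs].
have c1 : #|S1| <= k by rewrite cardsE; apply: leq_trans (card_size _) bt.
have c2 : #|S2| <= k * r.
  apply: leq_trans (leq_mul bt (leqnn r)).
  apply: card_bigcup_leq => v _; apply: card_overloaded => //.
  by rewrite (cz (fun t => v \in base t)); apply: leq_trans DL; apply: leq_trans (dg v); rewrite leq_addl.
have c3 : #|S3| <= q.
  by apply: card_overloaded => //; rewrite count_predT -(size_map fst) zE; apply: leq_trans NM.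
have [|w] := @set_avoid (S1 :|: S2 :|: S3).
  apply: leq_ltn_trans (leq_card_setU _ _) _; apply: leq_ltn_trans (leq_add (leq_card_setU _ _) (leqnn _)) _.
  lia.
rewrite !inE !negb_or => /andP[/andP[w1 w2] w3].
exists ((t, w) :: zs); split=> /=.
- by rewrite zE.
- by rewrite w1.
- move=> v w'; case: (boolP (v \in base t)) => vt /=; last exact: l1.
  case: (w =P w') => [<-|_]; last exact: l1.
  rewrite ltnNge; apply/negP=> le; case/negP: w2.
  by rewrite /S2 bigcup_seq; apply/bigcupP; exists v; rewrite ?inE.
- move=> w'; case: (w =P w') => [<-|_]; last exact: l2.
  by rewrite ltnNge; apply: contra w3; rewrite ?inE.
Qed.
End Greedy.

(** * Antisymmetric functions on pairs: divergence, parity, shifts and tokens *)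

Section Chains.
Variable V : finType.
Local Open Scope ring_scope.
Let A := {ffun V * V -> int}.

Definition arc (p q : V) : A := [ffun u => (u == (p, q))%:Z - (u == (q, p))%:Z].
Definition cyc x y z : A := arc x y + arc y z + arc z x.
(* With t_z = arc z x + arc z y, this is t_z - t_x: the effect of changing the middle vertex of {x, y,
  z} from x to z. *)
Definition shift (m : V * V * V) : A := arc m.1.1 m.1.2 *+ 2 + arc m.1.1 m.2 + arc m.2 m.1.2.
Definition dvg (b : A) x : int := \sum_y b (x, y).
Definition antisym (b : A) := forall x y, b (y, x) = - b (x, y).
(** Every pair is counted once, oriented by [enum_rank]. For antisymmetric functions the parity of
    this sum does not depend on the orientation. *)
Definition par (b : A) : int := \sum_(u : V * V | (enum_rank u.1 < enum_rank u.2)%N) b u.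

Lemma arcN p q : arc q p = - arc p q.
Proof. by apply/ffunP=> u; rewrite !ffunE opprB. Qed.

Lemma arcpp p : arc p p = 0.
Proof. by apply/ffunP=> u; rewrite !ffunE subrr. Qed.

(** Modulo shifts a directed triangle equals three times any of its arcs; this is the origin of the
    tokens. *)
Lemma shiftE z x y : shift (z, x, y) = arc z x *+ 3 - cyc z x y.
Proof. by rewrite /shift /cyc /= (arcN x y) (arcN z y); apply/ffunP=> u; rewrite !(ffunE, ffunMnE); ring. Qed.

Lemma antisym_arc p q : antisym (arc p q).
Proof. by move=> x y; rewrite !ffunE !xpair_eqE !(andbC (y == _)) opprB. Qed.

Lemma antisym_sum (I : Type) (s : seq I) (F : I -> A) : (forall i, antisym (F i)) -> antisym (\sum_(i
  <- s) F i).
Proof.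
by move=> h x y; rewrite !sum_ffunE -sumrN; apply: eq_bigr => i _; apply: h.
Qed.

Lemma antisymB a b : antisym a -> antisym b -> antisym (a - b).
Proof. by move=> ha hb x y; rewrite !ffunE ha hb; ring. Qed.

Lemma antisymMn a k : antisym a -> antisym (a *+ k).
Proof. by move=> ha x y; rewrite !ffunMnE ha mulNrn. Qed.

Lemma dvgD a b x : dvg (a + b) x = dvg a x + dvg b x.
Proof. by rewrite /dvg -big_split; apply: eq_bigr => y _; rewrite ffunE. Qed.

Lemma dvgB a b x : dvg (a - b) x = dvg a x - dvg b x.
Proof. by rewrite /dvg -sumrB; apply: eq_bigr => y _; rewrite !ffunE. Qed.

Lemma dvgN a x : dvg (- a) x = - dvg a x.
Proof. by rewrite /dvg -sumrN; apply: eq_bigr => y _; rewrite ffunE. Qed.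

Lemma dvgMn a k x : dvg (a *+ k) x = dvg a x *+ k.
Proof. by rewrite /dvg -sumrMnl; apply: eq_bigr => y _; rewrite ffunMnE. Qed.

Lemma dvg_sum (I : Type) (s : seq I) (P : pred I) (F : I -> A) x :
  dvg (\sum_(i <- s | P i) F i) x = \sum_(i <- s | P i) dvg (F i) x.
Proof. by rewrite /dvg exchange_big; apply: eq_bigr => y _; rewrite sum_ffunE. Qed.

Lemma dvg_arc p q x : dvg (arc p q) x = (x == p)%:Z - (x == q)%:Z.
Proof.
have E (a : V * V) : \sum_y ((x, y) == (a.1, a.2))%:Z = (x == a.1 :> V)%:Z :> int.
  rewrite (bigD1 a.2) //= xpair_eqE eqxx andbT big1 ?addr0 // => y /negbTE.
  by rewrite xpair_eqE => ->; rewrite andbF.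
by rewrite /dvg -(E (p, q)) -(E (q, p)) -sumrB; apply: eq_bigr => y _; rewrite ffunE.
Qed.

Lemma parD a b : par (a + b) = par a + par b.
Proof. by rewrite /par -big_split; apply: eq_bigr => y _; rewrite ffunE. Qed.

Lemma parN a : par (- a) = - par a.
Proof. by rewrite /par -sumrN; apply: eq_bigr => y _; rewrite ffunE. Qed.

Lemma parMn a k : par (a *+ k) = par a *+ k.
Proof. by rewrite /par -sumrMnl; apply: eq_bigr => y _; rewrite ffunMnE. Qed.

Lemma par_sum (I : Type) (s : seq I) (P : pred I) (F : I -> A) :
  par (\sum_(i <- s | P i) F i) = \sum_(i <- s | P i) par (F i).
Proof. by rewrite /par exchange_big; apply: eq_bigr => y _; rewrite sum_ffunE. Qed.

Lemma par_arc p q : p != q -> (par (arc p q) = 1 \/ par (arc p q) = -1).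
Proof.
have E a b : (enum_rank a < enum_rank b)%N -> par (arc a b) = 1.
  move=> lt; rewrite /par (bigD1 (a, b)) //= big1 ?addr0.
    by rewrite ffunE eqxx xpair_eqE; case: eqP => // E; rewrite E ltnn in lt.
  move=> u /andP[lu /negbTE nu]; rewrite ffunE nu; case: eqP => // E.
  by move: lu; rewrite E /= ltnNge ltnW.
move=> pq; have : enum_rank p != enum_rank q by rewrite (inj_eq enum_rank_inj).
rewrite -val_eqE /= neq_ltn => /orP[lt|lt]; [left|right]; first exact: E.
by rewrite arcN parN E.
Qed.

Lemma par_shift m : uniq [:: m.1.1; m.1.2; m.2] -> exists c : int, par (shift m) = c * 2.
Proof.
case: m => [[z x] y] /=; rewrite !inE negb_or andbT => /andP[/andP[zx zy] xy].
rewrite /shift /= !parD.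
have yx : y != x by rewrite eq_sym.
case: (par_arc zx) => ->; case: (par_arc zy) => ->; case: (par_arc yx) => ->;
  by [exists 2 | exists 1 | exists 0 | exists (-1) | exists (-2)].
Qed.

Definition pair_load (T : Type) (supp : T -> seq V) (s : seq T) x y :=
  count (fun t => (x \in supp t) && (y \in supp t)) s.
Definition vs3 (m : V * V * V) := [:: m.1.1; m.1.2; m.2].
Definition vs2 (t : V * V) := [:: t.1; t.2].

(** The shifts come in pairs: shift (a, b, c) + shift (c, b, a) is 3 (a -> b) + 3 (c -> b), as the
    two triangles are opposite. Over the four triples the tokens on {y, q}, {q, p} and {p, y'}
    cancel. *)
Lemma token_detour x y x' y' q p :
  arc x y *+ 3 + arc x' y' *+ 3 =
  \sum_(m <- [:: (x, y, q); (q, y, x); (y, q, p); (p, q, y); (q, p, y'); (y', p, q); (p, y', x');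
    (x', y', p)]) shift m.
Proof.
rewrite !big_cons big_nil /shift /=; apply/ffunP=> u; rewrite !(ffunE, ffunMnE); ring.
Qed.
End Chains.

(** * Cancelling an even number of tokens *)

Section Tokens.
Variable V : finType.
Local Notation n := #|V|.

Lemma count_leq_sum (T : Type) (s : seq T) (P : pred T) (F : T -> nat) :
  (forall t, P t -> 0 < F t) -> count P s <= \sum_(t <- s) F t.
Proof.
move=> H; elim: s => [|t s IH] /=; first by rewrite big_nil.
by rewrite big_cons leq_add //; case: (boolP (P t)) => // /H.
Qed.

(** Each item at [v] has a second vertex and so is counted in the load of some pair at [v]. *)
Lemma vertex_load (T : eqType) (supp : T -> seq V) (s : seq T) P v :
  {in s, forall t, v \in supp t -> exists2 w, w != v & w \in supp t} ->
  (forall w, w != v -> pair_load supp s v w <= P) ->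
  count (fun t => v \in supp t) s <= n * P.
Proof.
move=> H le; apply: (@leq_trans (\sum_(w | w != v) pair_load supp s v w)).
  elim: s H {le} => [|t s IH] H /=; first by [].
  rewrite big_split /= leq_add ?IH //; last by move=> u us; apply: H; rewrite inE us orbT.
  case: (boolP (v \in supp t)) => // /(H t (mem_head _ _))[w wv wt].
  by rewrite (bigD1 w) //= wt.
apply: leq_trans (leq_sum _ le) _; rewrite sum_nat_const leq_mul2r; apply/orP; right.
exact: max_card.
Qed.

Lemma size_leq_vertex_load (T : eqType) (supp : T -> seq V) (s : seq T) D :
  {in s, forall t, exists v, v \in supp t} ->
  (forall v, count (fun t => v \in supp t) s <= D) -> size s <= n * D.
Proof.
move=> H le; apply: (@leq_trans (\sum_v count (fun t => v \in supp t) s)); last first.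
  by apply: leq_trans (leq_sum _ (fun v _ => le v)) _; rewrite sum_nat_const leq_mul2r max_card orbT.
elim: s H {le} => [|t s IH] H //=.
rewrite big_split /= -add1n leq_add ?IH //; last by move=> u us; apply: H; rewrite inE us orbT.
by have [v vt] := H t (mem_head _ _); rewrite (bigD1 v) //= vt.
Qed.

Lemma pair_up (T : Type) (s : seq T) : ~~ odd (size s) ->
  exists qs : seq (T * T), s = flatten [seq [:: a.1; a.2] | a <- qs].
Proof.
have [k] := ubnP (size s); elim: k s => // k IH [|a [|b s]] //=; first by exists [::].
rewrite negbK => lt /IH[|qs ->]; first by lia.
by exists ((a, b) :: qs).
Qed.

Local Open Scope ring_scope.
Let quad := ((V * V) * (V * V))%type.
Definition vs4 (t : quad) := [:: t.1.1; t.1.2; t.2.1; t.2.2].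
Definition vs5 (z : quad * V) := z.2 :: vs4 z.1.

(* Modulo shifts 3 (x -> y) = 3 (y -> z) for all distinct x, y, z; the detour passes a token through
   x -> y -> q -> p -> y' -> x', where it cancels the token on x' -> y'. *)
Definition detour (z : quad * V * V) : seq (V * V * V) :=
  let: (((x, y), (x', y')), q, p) := z in
  [:: (x, y, q); (q, y, x); (y, q, p); (p, q, y)] ++
  [:: (q, p, y'); (y', p, q); (p, y', x'); (x', y', p)].

(** Each of the eight shifts lives on x, y, q, p or on x', y', q, p. A pair inside it is thus one of
    the two tokens or contains q or p, and the pairs at q and p are those whose load the greedy
    choices control. No shift needs a pair such as {x, x'}, whose load could not be bounded. *)
Lemma detour_load z u v : u != v ->
  (pair_load (@vs3 V) (detour z) u v <=
   8 * (((u \in vs2 z.1.1.1) && (v \in vs2 z.1.1.1)) + ((u \in vs2 z.1.1.2) && (v \in vs2 z.1.1.2)) +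
    (((u \in vs4 z.1.1) && (z.1.2 == v)) + ((v \in vs4 z.1.1) && (z.1.2 == u))) +
    (((u \in vs5 z.1) && (z.2 == v)) + ((v \in vs5 z.1) && (z.2 == u)))))%N.
Proof.
move=> uv; set S := (X in (_ <= 8 * X)%N).
have [h|h] := boolP (has (fun m => (u \in vs3 m) && (v \in vs3 m)) (detour z)); last first.
  by move: h; rewrite has_count -leqNgt leqn0 /pair_load => /eqP ->.
have S0 : (0 < S)%N; last first.
  apply: leq_trans (count_size _ _) _.
  have -> : size (detour z) = 8 by case: (z) => [[[[x y] [x' y']] q] p].
  by rewrite -{1}(muln1 8) leq_pmul2l.
move: h; rewrite {}/S; case: z => [[[[x y] [x' y']] q] p]; rewrite /detour has_cat.
have aux a b (X : seq V) : u \in X -> v \in X -> {subset X <= [:: a; b; q; p]} ->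
  [|| (u \in [:: a; b]) && (v \in [:: a; b]), (u \in [:: a; b]) && (q == v),
    (v \in [:: a; b]) && (q == u), (u \in [:: q; a; b]) && (p == v) | (v \in [:: q; a; b]) && (p == u)].
  move=> uX vX sub; move: (sub _ uX) (sub _ vX) uv; rewrite !inE.
  by case/or4P=> /eqP ->; case/or4P=> /eqP ->; rewrite ?eqxx ?orbT.
have fin a b : {subset [:: a; b] <= [:: x; y; x'; y']} ->
  (u \in [:: a; b]) && (v \in [:: a; b]) ||
  [|| (u \in [:: a; b]) && (q == v), (v \in [:: a; b]) && (q == u),
    (u \in [:: q; a; b]) && (p == v) | (v \in [:: q; a; b]) && (p == u)] ->
  (0 < ((u \in [:: a; b]) && (v \in [:: a; b])) + (((u \in [:: x; y; x';
    y']) && (q == v)) + ((v \in [:: x; y; x'; y']) && (q == u))) +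
    (((u \in [:: q; x; y; x'; y']) && (p == v)) + ((v \in [:: q; x; y; x'; y']) && (p == u))))%N.
  move=> sub /orP[->|] //; rewrite (in_cons q [:: a; b] u) (in_cons q [:: a; b] v).
  have su := sub u; have sv := sub v.
  rewrite (in_cons q [:: x; y; x'; y'] u) (in_cons q [:: x; y; x'; y'] v); move: su sv.
  move: (u \in [:: a; b]) (v \in [:: a; b]) => b1 b2.
  move: (q == v) (q == u) (p == v) (p == u) (u == q) (v == q) => c1 c2 c3 c4 c5 c6 h1 h2.
  rewrite !lt0n !addn_eq0 !eqb0.
  by case: b1 h1 => [/(_ isT) ->|_]; case: b2 h2 => [/(_ isT) ->|_]; case: c1; case: c2; case: c3;
    case: c4; case: c5; case: c6; rewrite ?orbT ?andbF.
case/orP=> /hasP[m min /andP[um vm]].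
  have /(aux x y _ um vm) : {subset vs3 m <= [:: x; y; q; p]}.
    by move: min; rewrite !inE => /or4P[] /eqP -> w; rewrite /vs3 !inE /= => /or3P[] /eqP ->;
      rewrite eqxx ?orbT.
  move/fin => F; rewrite /vs5 /vs4 /=.
  apply: leq_trans (F _) _; last by rewrite /vs2 /= !leq_add2r leq_addr.
  by move=> w; rewrite !inE => /orP[] ->; rewrite ?orbT.
have /(aux x' y' _ um vm) : {subset vs3 m <= [:: x'; y'; q; p]}.
  by move: min; rewrite !inE => /or4P[] /eqP -> w; rewrite /vs3 !inE /= => /or3P[] /eqP ->;
    rewrite eqxx ?orbT.
move/fin => F; rewrite /vs5 /vs4 /=.
apply: leq_trans (F _) _; last by rewrite /vs2 /= !leq_add2r leq_addl.
by move=> w; rewrite !inE => /orP[] ->; rewrite ?orbT.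
Qed.

Lemma detour_uniq z : z.1.1.1.1 != z.1.1.1.2 -> z.1.1.2.1 != z.1.1.2.2 ->
  z.1.2 \notin vs4 z.1.1 -> z.2 \notin vs5 z.1 -> all (fun m => uniq (vs3 m)) (detour z).
Proof.
case: z => [[[[x y] [x' y']] q] p] /= xy xy'; rewrite /vs5 /vs4 /vs3 /= !inE !negb_or.
case/and4P=> q1 q2 q3 q4 /and5P[pq p1 p2 p3 p4].
by do !(apply/andP; split=> //); rewrite // eq_sym.
Qed.

Lemma pair_load_flatten (T U : Type) (F : T -> seq U) (supp : U -> seq V) (s : seq T) x y :
  pair_load supp (flatten [seq F t | t <- s]) x y = (\sum_(t <- s) pair_load supp (F t) x y)%N.
Proof.
by rewrite /pair_load count_flatten -map_comp sumnE big_map.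
Qed.

Lemma cancel_tokens (P : nat) (tk : seq (V * V)) : (20 <= n)%N -> (0 < P)%N ->
  all (fun t => t.1 != t.2) tk -> ~~ odd (size tk) ->
  (forall x y, x != y -> (pair_load (@vs2 V) tk x y <= P)%N) ->
  exists ms : seq (V * V * V), [/\ \sum_(t <- tk) arc t.1 t.2 *+ 3 = \sum_(m <- ms) shift m,
    all (fun m => uniq (vs3 m)) ms &
    forall x y, x != y -> (pair_load (@vs3 V) ms x y <= 8 * (233 * P))%N].
Proof.
move=> n20 P0 tkd /pair_up[qd tkE] tkP.
have qdd : {in qd, forall t, t.1.1 != t.1.2 /\ t.2.1 != t.2.2}.
  move=> [t t'] tq; split; apply: (allP tkd); rewrite tkE; apply/flattenP; exists [:: t; t'];
    rewrite ?inE ?eqxx ?orbT //; by apply/mapP; exists (t, t').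
have qdl x y : x != y -> (count (fun t => (x \in vs2 t.1) && (y \in vs2 t.1)) qd +
    count (fun t => (x \in vs2 t.2) && (y \in vs2 t.2)) qd <= P)%N.
  move=> xy; apply: leq_trans (tkP x y xy); rewrite tkE pair_load_flatten.
  rewrite -!sum1_count !(big_mkcond (fun t => _ && _)) -big_split /=; apply: leq_sum => t _.
  by rewrite /pair_load /= addn0; do 2 case: (_ && _).
have dtk v : (count (fun t => v \in vs2 t) tk <= n * P)%N.
  apply: vertex_load => [t tt|w wv]; last by apply: tkP; rewrite eq_sym.
  have := allP tkd t tt; rewrite !inE => t12 /orP[]/eqP ->.
    by exists t.2; rewrite ?inE ?eqxx ?orbT // eq_sym.
  by exists t.1; rewrite ?inE ?eqxx ?orbT.
have dqd v : (count (fun t => v \in vs4 t) qd <= n * P)%N.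
  apply: leq_trans (dtk v); rewrite tkE count_flatten -map_comp sumnE big_map.
  apply: count_leq_sum => -[[a b] [c d]]; rewrite /= !inE.
  by case/or4P=> ->; rewrite ?orbT //=; lia.
have Nqd : (size qd <= n * (n * P))%N.
  by apply: (size_leq_vertex_load (supp := vs4)) => // t _; exists t.1.1; rewrite inE eqxx.
(* The choice of q. Here about n / 2 vertices are forbidden. The cap [4 * (n * P)] on the uses of
   one q is what bounds vertex loads in the choice of p. *)
have [|||||| z1 [z1E z1a z1l z1m]] := @greedy_vertex V quad vs4 qd 4 (n * P) (16 * P) (n %/ 16 + 1) (4
  * (n * P)) (n %/ 4 + 1) _ dqd.
- by [].
- lia.
- have := divn_eq n 16; have := ltn_pmod n (isT : (0 < 16)%N); nia.
- nia.
- apply: leq_trans Nqd _; have := divn_eq n 4; have := ltn_pmod n (isT : (0 < 4)%N); nia.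
- lia.
have d5 v : (count (fun z => v \in vs5 z) z1 <= 5 * (n * P))%N.
  apply: (@leq_trans (count (fun z => z.2 == v) z1 + count (fun z => v \in vs4 z.1) z1)%N).
    rewrite -count_predUI; apply: leq_trans (leq_addr _ _); apply: sub_count => z /=.
    by rewrite /vs5 inE eq_sym.
  have -> : count (fun z => v \in vs4 z.1) z1 = count (fun t => v \in vs4 t) qd by rewrite -z1E count_map.
  by have := z1m v; have := dqd v; lia.
(* The choice of p. No vertex can reach the cap [(size z1).+1]: from here on only pair loads
   matter. *)
have [|||||| z2 [z2E z2a z2l _]] := @greedy_vertex V (quad * V)%type vs5 z1 5 (5 * (n * P)) (100 * P)
  (n %/ 20 + 1) (size z1).+1 1 _ d5.
- by [].
- lia.
- have := divn_eq n 20; have := ltn_pmod n (isT : (0 < 20)%N); nia.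
- by [].
- by rewrite muln1.
- lia.
have c1 (Q : pred quad) : count (fun z : quad * V * V => Q z.1.1) z2 = count Q qd.
  by rewrite -z1E -z2E !count_map.
have c2 (Q : pred (quad * V)) : count (fun z : quad * V * V => Q z.1) z2 = count Q z1.
  by rewrite -z2E !count_map.
exists (flatten [seq detour z | z <- z2]); split.
- rewrite big_flatten big_map; have -> : tk = flatten [seq [:: z.1.1.1; z.1.1.2] | z <- z2].
    by rewrite tkE -z1E -z2E -!map_comp.
  rewrite big_flatten big_map; apply: eq_bigr => -[[[[x y] [x' y']] q] p] _.
  by rewrite big_cons big_seq1 /= (token_detour x y x' y' q p).
- apply/allP=> m /flattenP[s /mapP[z zz ->]]; move: m; apply/allP/detour_uniq.
  + by have /qdd[] : z.1.1 \in qd by rewrite -z1E -z2E -map_comp; apply/mapP; exists z.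
  + by have /qdd[] : z.1.1 \in qd by rewrite -z1E -z2E -map_comp; apply/mapP; exists z.
  + by apply: (allP z1a); rewrite -z2E; apply/mapP; exists z.
  + exact: (allP z2a z zz).
- move=> x y xy; rewrite pair_load_flatten.
  apply: leq_trans (leq_sum _ (fun z _ => detour_load z xy)) _.
  rewrite -big_distrr leq_mul2l /= !big_split /=.
  have cE (Q : pred (quad * V * V)) : (\sum_(z <- z2) Q z = count Q z2)%N.
    by rewrite -sum1_count [RHS]big_mkcond; apply: eq_bigr => z _; case: (Q z).
  rewrite (cE (fun z => (x \in vs2 z.1.1.1) && _)) (cE (fun z => (x \in vs2 z.1.1.2) && _)).
  rewrite (cE (fun z => (x \in vs4 z.1.1) && _)) (cE (fun z => (y \in vs4 z.1.1) && _)).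
  rewrite (cE (fun z => (x \in vs5 z.1) && _)) (cE (fun z => (y \in vs5 z.1) && _)).
  rewrite (c1 (fun t => (x \in vs2 t.1) && (y \in vs2 t.1))) (c1 (fun t => (x \in vs2 t.2) && (y \in
    vs2 t.2))).
  rewrite (c2 (fun t => (x \in vs4 t.1) && (t.2 == y))) (c2 (fun t => (y \in vs4 t.1) && (t.2 == x))).
  (* The origin of 233 = 1 + 2 * 16 + 2 * 100: tokens, pairs at q, pairs at p. *)
  apply: (@leq_trans (P + (16 * P + 16 * P) + (100 * P + 100 * P))%N); last by lia.
  exact: leq_add (leq_add (qdl x y xy) (leq_add (z1l x y) (z1l y x))) (leq_add (z2l x y) (z2l y x)).
Qed.
End Tokens.

(** * Circulations as sums of permutations, coned off to roots *)

Section Circulations.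
Variable V : finType.
Local Notation n := #|V|.
Local Open Scope ring_scope.
Let A := {ffun V * V -> int}.

Definition pos_part (z : int) : nat := if z is Posz k then k else 0.

Lemma sum_Posz (I : Type) (s : seq I) (P : pred I) (F : I -> nat) :
  (\sum_(i <- s | P i) F i)%N%:Z = \sum_(i <- s | P i) (F i)%:Z.
Proof. exact: (big_morph Posz PoszD (erefl _)). Qed.

Lemma pos_partB z : (pos_part z)%:Z - (pos_part (- z))%:Z = z.
Proof. by case: z => [[|k]|k] //=; rewrite ?subr0 ?sub0r ?NegzE. Qed.

Lemma pos_partD z : (pos_part z + pos_part (- z))%N = `|z|%N.
Proof. by case: z => [[|k]|k] //=; rewrite ?addn0. Qed.

Lemma pos_part_leq z (B : nat) : `|z| <= B%:Z -> (pos_part z <= B)%N.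
Proof. by case: z => k /=; lia. Qed.

Lemma antisym0 (b : A) x : antisym b -> b (x, x) = 0.
Proof. by move/(_ x x); lia. Qed.

Lemma sum_eq_op (x : V) (F : V -> nat) : (\sum_w (w == x) * F w = F x)%N.
Proof. by rewrite (bigD1 x) //= eqxx mul1n big1 ?addn0 // => w /negbTE ->. Qed.

(* The diagonal pads all row and column sums to [B * n]. *)
Definition padded_flow (b : A) (B : nat) u v : nat :=
  if u == v then (B * n - \sum_(w | w != u) pos_part (b (u, w)))%N else pos_part (b (u, v)).

Lemma padded_flow_row (b : A) (B : nat) u : (forall x y, `|b (x, y)| <= B%:Z) ->
  (\sum_v padded_flow b B u v = B * n)%N.
Proof.
move=> bB; rewrite (bigD1 u) //= {1}/padded_flow eqxx.
rewrite [X in (_ + X)%N](eq_bigr (fun w => pos_part (b (u, w)))); last first.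
  by move=> w /negbTE; rewrite /padded_flow eq_sym => ->.
rewrite subnK // (leq_trans (leq_sum _ (fun w _ => pos_part_leq (bB u w)))) //.
by rewrite sum_nat_const mulnC leq_mul2l max_card orbT.
Qed.

Lemma pos_part_sum_circ (b : A) u : antisym b -> dvg b u = 0 ->
  (\sum_(w | w != u) pos_part (b (u, w)) = \sum_(w | w != u) pos_part (b (w, u)))%N.
Proof.
move=> anti d0; apply/eqP; rewrite -eqz_nat -subr_eq0 !sum_Posz -sumrB /=.
rewrite (eq_bigr (fun w => b (u, w))); last by move=> w _; rewrite (anti u w) pos_partB.
have := d0; rewrite /dvg (bigD1 u) //= antisym0 // add0r => ->; exact: eqxx.
Qed.

Lemma padded_flow_col (b : A) (B : nat) v : antisym b -> dvg b v = 0 ->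
  (forall x y, `|b (x, y)| <= B%:Z) -> (\sum_u padded_flow b B u v = B * n)%N.
Proof.
move=> anti d0 bB; rewrite (bigD1 v) //= {1}/padded_flow eqxx pos_part_sum_circ //.
rewrite [X in (_ + X)%N](eq_bigr (fun w => pos_part (b (w, v)))); last first.
  by move=> w /negbTE; rewrite /padded_flow => ->.
rewrite subnK // (leq_trans (leq_sum _ (fun w _ => pos_part_leq (bB w v)))) //.
by rewrite sum_nat_const mulnC leq_mul2l max_card orbT.
Qed.

(** Fixed points contribute [arc x x = 0], so the diagonal padding disappears; off the diagonal the
    multiplicities of (u, v) and (v, u) are the positive and negative parts of b (u, v). *)
Lemma sum_perm_arcs (ps : seq {perm V}) (b : A) (B : nat) : antisym b ->
  (forall x y, padded_flow b B x y = count (fun s : {perm V} => s x == y) ps) ->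
  b = \sum_(s <- ps) \sum_x arc x (s x).
Proof.
move=> anti psE; apply/ffunP=> -[u v]; rewrite sum_ffunE.
rewrite (eq_bigr (fun s : {perm V} => (s u == v)%:Z - (s v == u)%:Z)); last first.
  move=> s _; rewrite sum_ffunE (eq_bigr (fun x => ((x == u) * (s x == v))%N%:Z - ((x == v) * (s x ==
    u))%N%:Z)).
    by rewrite sumrB -!sum_Posz !sum_eq_op.
  by move=> x _; rewrite ffunE !xpair_eqE !mulnb !(eq_sym x) !(eq_sym (s x)) (andbC (u == s x)).
have cE x y : \sum_(s <- ps) (s x == y)%:Z = (padded_flow b B x y)%:Z.
  by rewrite psE -sum1_count sum_Posz [RHS]big_mkcond; apply: eq_bigr => s _; case: eqP.
rewrite sumrB !cE /padded_flow; case: (u =P v) => [<-|/eqP/negbTE uv]; first by rewrite eqxx subrr antisym0.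
by rewrite eq_sym uv (anti u v) pos_partB.
Qed.

(** Fixed points of a permutation and arcs at the root give degenerate triangles; since these
    vanish, only genuine triples are kept. *)
Lemma cyc_degenerate x y z : ~~ uniq [:: x; y; z] -> cyc x y z = 0 :> A.
Proof.
rewrite /= !inE andbT negb_and !negbK => /orP[/orP[/eqP->|/eqP->]|/eqP->];
rewrite /cyc arcpp ?add0r ?addr0 ?(arcN z y) ?(arcN z x) ?addNr ?subrr //.
Qed.

Lemma cyc_token x y z : cyc x y z = arc x y *+ 3 + shift (y, x, z) :> A.
Proof.
by rewrite shiftE /cyc (arcN x y) (arcN z x) (arcN z y); apply/ffunP=> u; rewrite !(ffunE, ffunMnE); ring.
Qed.

(* As s is a permutation, the arcs at the root cancel. *)
Lemma sum_cyc_root r (s : {perm V}) : \sum_x cyc r x (s x) = \sum_x arc x (s x) :> A.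
Proof.
rewrite /cyc !big_split /= addrAC -[RHS]add0r; congr (_ + _).
rewrite -[X in _ + X](reindex_inj (P := predT) (F := fun x => arc x r) (@perm_inj _ s)) -big_split big1
  // => x _.
by rewrite /= (arcN x r) addNr.
Qed.

(* There are [B * n] permutations, and every vertex is the root of [B] of them. *)
Lemma circulation_tokens (b : A) (B : nat) : antisym b -> (forall x, dvg b x = 0) ->
  (forall x y, `|b (x, y)| <= B%:Z) ->
  exists (tk : seq (V * V)) (ms : seq (V * V * V)),
  [/\ b = \sum_(t <- tk) arc t.1 t.2 *+ 3 + \sum_(m <- ms) shift m,
    all (fun t => t.1 != t.2) tk /\ all (fun m => uniq (vs3 m)) ms,
    forall x y, x != y -> (pair_load (@vs2 V) tk x y <= 2 * B)%N &
    forall x y, x != y -> (pair_load (@vs3 V) ms x y <= 5 * B)%N].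
Proof.
move=> anti d0 bB.
have [ps psz psE] := birkhoff (fun u => padded_flow_row u bB) (fun v => padded_flow_col anti (d0 v) bB).
pose roots := flatten [seq nseq B r | r <- enum V].
have rsz : size roots = (B * n)%N.
  rewrite size_flatten /shape -map_comp sumnE big_map.
  under eq_bigr => r _ do rewrite /= size_nseq.
  by rewrite big_enum sum_nat_const mulnC.
pose zs := zip roots ps.
have sumz (F : {perm V} -> A) : \sum_(z <- zs) F z.2 = \sum_(s <- ps) F s.
  by rewrite -[in RHS](@unzip2_zip _ _ roots ps) ?big_map // psz rsz.
have cr u : (\sum_(z <- zs) (z.1 == u) = B)%N.
  rewrite -(big_map fst predT (fun r => nat_of_bool (r == u))) -/(unzip1 zs) unzip1_zip ?psz ?rsz //.
  rewrite big_flatten big_map big_enum /=; under eq_bigr => r _ do rewrite big_nseq iter_addn addn0.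
  by under eq_bigr => r _ do rewrite mulnC mulnC; rewrite sum_eq_op.
have cs u v : (\sum_(z <- zs) (z.2 u == v) = padded_flow b B u v)%N.
  rewrite psE -sum1_count -[in RHS](@unzip2_zip _ _ roots ps) ?psz ?rsz //.
  by rewrite big_map [RHS]big_mkcond; apply: eq_bigr => z _; case: eqP.
pose tl := [seq (z.1, x, (z.2 : {perm V}) x) | z : V * {perm V} <- zs, x : V <- enum V].
pose tl' := [seq m <- tl | uniq (vs3 m)].
exists [seq (m.1.1, m.1.2) | m <- tl'], [seq (m.1.2, m.1.1, m.2) | m <- tl'].
split.
- rewrite !big_map -big_split /=.
  rewrite (eq_bigr (fun m => cyc m.1.1 m.1.2 m.2)) => [|m _]; last by rewrite cyc_token.
  rewrite big_filter big_mkcond (eq_bigr (fun m => cyc m.1.1 m.1.2 m.2)) => [|m _]; last first.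
    by case: ifPn => // /cyc_degenerate ->.
  rewrite big_allpairs_dep.
  under eq_bigr => z _ do rewrite big_enum /= sum_cyc_root.
  by rewrite (sumz (fun s => \sum_x arc x (s x))) -(sum_perm_arcs anti psE).
- split; apply/allP=> t /mapP[m]; rewrite mem_filter => /andP[+ _] ->; rewrite /vs3 /= !inE !negb_or.
    by case/andP=> /andP[].
  by case/andP=> /andP[? ?] /andP[? _]; rewrite eq_sym; apply/and3P; split=> //; apply/andP.
- move=> x y xy; rewrite /pair_load count_map count_filter.
  apply: (@leq_trans (\sum_(m <- tl) ((m.1.1 == x) && (m.1.2 == y) + (m.1.1 == y) && (m.1.2 == x)))%N).
    apply: count_leq_sum => -[[r w] s] /=; rewrite !inE => /andP[/andP[/orP[]/eqP E1 /orP[]/eqP E2] _];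
      by move: xy; rewrite E1 E2 !eqxx ?addn1 ?addn_gt0 ?orbT.
  rewrite big_allpairs_dep.
  under eq_bigr => z _.
    rewrite big_enum big_split /=.
    under eq_bigr => w _ do rewrite -mulnb mulnC.
    under [X in (_ + X)%N]eq_bigr => w _ do rewrite -mulnb mulnC.
    rewrite (sum_eq_op y (fun _ => nat_of_bool (z.1 == x))) (sum_eq_op x (fun _ => nat_of_bool (z.1 == y))).
    over.
  by rewrite big_split /= !cr; lia.
- move=> x y xy; rewrite /pair_load count_map count_filter.
  (* A triple (r, w, s w) covers {x, y} by r and w, at most 2 B times, by r and s w, again 2 B
     times, or by w and s w, which happens |b (x, y)| <= B times. *)
  apply: (@leq_trans (\sum_(m <- tl) (
     ((m.1.2 == y) * (m.1.1 == x) + (m.1.2 == x) * (m.1.1 == y)) +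
     ((m.2 == y) * (m.1.1 == x) + (m.2 == x) * (m.1.1 == y)) +
     ((m.1.2 == x) * (m.2 == y) + (m.1.2 == y) * (m.2 == x))))%N).
    apply: count_leq_sum => -[[r w] s] /=;
      rewrite !inE => /andP[/andP[/or3P[]/eqP E1 /or3P[]/eqP E2] _]; by move: xy;
        rewrite E1 E2 !eqxx ?muln1 ?addn_gt0 ?orbT.
  rewrite big_allpairs_dep.
  under eq_bigr => z _.
    rewrite big_enum !big_split /=.
    rewrite (sum_eq_op y (fun _ => nat_of_bool (z.1 == x))) (sum_eq_op x (fun _ => nat_of_bool (z.1 == y))).
    rewrite (sum_eq_op x (fun w => nat_of_bool (z.2 w == y))) (sum_eq_op y (fun w => nat_of_bool (z.2 w
      == x))).
    rewrite (reindex_inj (@perm_inj _ (z.2)^-1)%g) [X in ((_ + (_ + X)) + _)%N](reindex_inj (@perm_inj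
      _ (z.2)^-1)%g) /=.
    under eq_bigr => w _ do rewrite permKV.
    under [X in ((_ + (_ + X)) + _)%N]eq_bigr => w _ do rewrite permKV.
    rewrite (sum_eq_op y (fun _ => nat_of_bool (z.1 == x))) (sum_eq_op x (fun _ => nat_of_bool (z.1 == y))).
    over.
  rewrite !big_split /= !cr !cs /padded_flow (eq_sym y x) (negbTE xy) (anti x y).
  have : (`|b (x, y)| <= B)%N by rewrite -lez_nat abszE; apply: bB.
  rewrite pos_partD; lia.
Qed.
End Circulations.

(** * Removing the divergence, and the full decomposition *)

Section Decomposition.
Variable V : finType.
Local Notation n := #|V|.
Local Open Scope ring_scope.
Let A := {ffun V * V -> int}.

Lemma sum_dvg_antisym (b : A) : antisym b -> \sum_x dvg b x = 0.
Proof.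
move=> anti; have : \sum_x dvg b x = - \sum_x dvg b x; last by lia.
rewrite -sumrN; under [RHS]eq_bigr => x _ do rewrite /dvg -sumrN.
rewrite exchange_big; apply: eq_bigr => x _; apply: eq_bigr => y _; exact: anti.
Qed.

Lemma norm_sum_arcs (tk : seq (V * V)) x y :
  `|\sum_(t <- tk) (arc t.1 t.2 : A) (x, y)| <= (pair_load (@vs2 V) tk x y)%:Z.
Proof.
elim: tk => [|t tk IH]; first by rewrite big_nil.
rewrite big_cons /pair_load /= PoszD; apply: le_trans (ler_normD _ _) _; apply: lerD => //.
rewrite ffunE !xpair_eqE !inE.
by case: (x == t.1); case: (y == t.2); case: (x == t.2); case: (y == t.1).
Qed.

Lemma count_flatten_nseq (F : V -> nat) v :
  count (pred1 v) (flatten [seq nseq (F x) x | x <- enum V]) = F v.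
Proof.
rewrite count_flatten -map_comp sumnE big_map big_enum /=.
by under eq_bigr => x _ do rewrite count_nseq; rewrite -[RHS](sum_eq_op v F).
Qed.

Lemma size_flatten_nseq (F : V -> nat) :
  size (flatten [seq nseq (F x) x | x <- enum V]) = (\sum_x F x)%N.
Proof.
rewrite size_flatten /shape -map_comp sumnE big_map big_enum /=.
by under eq_bigr => x _ do rewrite size_nseq.
Qed.

(** The whole sum and all shifts have even [par], while each token contributes 3 or -3. *)
Lemma token_count_even (tk : seq (V * V)) (ms : seq (V * V * V)) :
  all (fun t => t.1 != t.2) tk -> all (fun m => uniq (vs3 m)) ms ->
  (exists c : int, par (\sum_(t <- tk) arc t.1 t.2 *+ 3 + \sum_(m <- ms) shift m) = c * 2) ->
  ~~ odd (size tk).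
Proof.
move=> At Am [c]; rewrite parD !par_sum.
have [c1 ->] : exists c1 : int, \sum_(m <- ms) par (shift m) = c1 * 2.
  elim: ms Am => [|m ms IH] /=; first by exists 0; rewrite big_nil.
  by case/andP=> /par_shift[a E] /IH[d F]; exists (a + d); rewrite big_cons E F; ring.
have [c2 ->] : exists c2 : int, \sum_(t <- tk) par (arc t.1 t.2 *+ 3) = c2 * 2 + (size tk)%:Z.
  elim: tk At => [|t tk IH] /=; first by exists 0; rewrite big_nil.
  case/andP=> /par_arc E /IH[d F]; rewrite big_cons F parMn.
  by case: E => ->; [exists (d + 1) | exists (d - 2)]; lia.
move=> E; lia.
Qed.

(** A vertex of divergence 3 k is listed k times as a source or -k times as a sink; the two lists
    have equal length because the divergences add up to zero. Each source is joined to its sink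
    through a greedily chosen vertex, since direct tokens could pile up on one pair. *)
Lemma spread_tokens (b : A) (B : nat) : (20 <= n)%N -> (0 < B)%N -> antisym b ->
  (forall x y, `|b (x, y)| <= B%:Z) -> (forall x, exists k : int, dvg b x = k * 3) ->
  exists tk : seq (V * V), [/\ all (fun t => t.1 != t.2) tk,
    forall x, dvg (\sum_(t <- tk) arc t.1 t.2 *+ 3) x = dvg b x &
    forall x y, x != y -> (pair_load (@vs2 V) tk x y <= 16 * B)%N].
Proof.
move=> n20 B0 anti bB d3.
pose k x := (dvg b x %/ 3)%Z.
have kE x : dvg b x = k x * 3 by rewrite /k; have [c ->] := d3 x; rewrite mulzK.
have k0 : \sum_x k x = 0.
  have := sum_dvg_antisym anti; under eq_bigr => x _ do rewrite kE.
  by rewrite -mulr_suml => /eqP; rewrite mulf_eq0 orbF => /eqP.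
have kB x : (`|k x| <= n * B)%N.
  have : `|dvg b x| <= (n * B)%N%:Z.
    apply: le_trans (ler_norm_sum _ _ _) _; apply: le_trans (ler_sum _ (fun y _ => bB x y)) _.
    by rewrite sumr_const -mulr_natl natz PoszM.
  rewrite kE; lia.
pose sl := flatten [seq nseq (pos_part (k x)) x | x <- enum V].
pose dl := flatten [seq nseq (pos_part (- k x)) x | x <- enum V].
have szE : size sl = size dl.
  apply/eqP; rewrite !size_flatten_nseq -eqz_nat -subr_eq0 !sum_Posz -sumrB.
  by under eq_bigr => x _ do rewrite pos_partB; rewrite k0.
pose ts := zip sl dl.
have u1 : unzip1 ts = sl by rewrite unzip1_zip ?szE.
have u2 : unzip2 ts = dl by rewrite unzip2_zip ?szE.
have dg v : (count (fun t => v \in vs2 t) ts <= n * B)%N.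
  apply: (@leq_trans (count (pred1 v) sl + count (pred1 v) dl)%N).
    rewrite -u1 -u2 !count_map -count_predUI; apply: leq_trans (leq_addr _ _).
    by apply: sub_count => t /=; rewrite !inE !(eq_sym v).
  by rewrite !count_flatten_nseq pos_partD.
have [|||||| zs [zE za zl _]] := @greedy_vertex V (V * V)%type (@vs2 V) ts 2 (n * B) (4 * B) (n %/ 4 +
  1) (size ts).+1 1 _ dg.
- by [].
- lia.
- have := divn_eq n 4; have := ltn_pmod n (isT : (0 < 4)%N); nia.
- by [].
- by rewrite muln1.
- lia.
exists (flatten [seq [:: (z.1.1, z.2); (z.2, z.1.2)] | z <- zs]); split.
- apply/allP=> t /flattenP[s /mapP[z /(allP za) + ->]]; rewrite !inE negb_or => /andP[z1 z2].
  by case/orP=> /eqP -> //=; rewrite eq_sym.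
- move=> x; rewrite dvg_sum big_flatten big_map kE.
  under eq_bigr => z _ do rewrite big_cons big_seq1 /= !dvgMn !dvg_arc.
  rewrite (eq_bigr (fun z : V * V * V => ((z.1.1 == x)%:Z - (z.1.2 == x)%:Z) * 3)); last first.
    by move=> z _; rewrite !(eq_sym x); ring.
  rewrite -mulr_suml; congr (_ * _).
  rewrite -(big_map fst predT (fun t : V * V => (t.1 == x)%:Z - (t.2 == x)%:Z)) zE sumrB.
  rewrite -(big_map fst predT (fun v => (v == x)%:Z)) -(big_map snd predT (fun v => (v == x)%:Z)).
  rewrite -/(unzip1 ts) -/(unzip2 ts) u1 u2 -!sum_Posz.
  have cE (s : seq V) : (\sum_(v <- s) (v == x) = count (pred1 x) s)%N.
    by rewrite -sum1_count [RHS]big_mkcond; apply: eq_bigr => v _ /=; case: eqP.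
  by rewrite !cE !count_flatten_nseq pos_partB.
- move=> x y xy; rewrite pair_load_flatten.
  apply: (@leq_trans (\sum_(z <- zs) 2 * ((x \in vs2 z.1) && (z.2 == y) + (y \in vs2 z.1) && (z.2 == x)))%N).
    apply: leq_sum => -[[s d] q] _; rewrite /pair_load /vs2 /= !inE.
    have h v : ~~ ((x == v) && (y == v)).
      by apply: contra xy => /andP[/eqP -> /eqP ->].
    move: (h s) (h q) (h d); rewrite !(eq_sym q).
    by case: (x == s); case: (y == s); case: (x == q); case: (y == q); case: (x == d); case: (y == d).
  rewrite -big_distrr /= big_split /=.
  have cE (Q : pred (V * V * V)) : (\sum_(z <- zs) Q z = count Q zs)%N.
    by rewrite -sum1_count [RHS]big_mkcond; apply: eq_bigr => z _; case: (Q z).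
  rewrite (cE (fun z => (x \in vs2 z.1) && _)) (cE (fun z => (y \in vs2 z.1) && _)).
  apply: (@leq_trans (2 * (4 * B + 4 * B))%N); last by lia.
  by rewrite leq_mul2l leq_add.
Qed.

End Decomposition.

(** The two invariants of shifts are the only obstructions, at a cost linear in [B]. As [C] is
    absolute, an imbalance of a tiny multiple of n needs only a small multiple of n shifts at each
    pair. *)
Lemma shift_decomposition : exists C : nat, forall (V : finType) (b : {ffun V * V -> int}) (B : nat),
  20 <= #|V| -> 0 < B -> antisym b ->
  (forall x y, `|b (x, y)| <= B%:Z)%R -> (forall x, exists k : int, dvg b x = k * 3)%R ->
  (exists c : int, par b = c * 2)%R ->
  exists ms : seq (V * V * V), [/\ b = (\sum_(m <- ms) shift m)%R,
    all (fun m => uniq (vs3 m)) ms &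
    forall x y, x != y -> pair_load (@vs3 V) ms x y <= C * B].
Proof.
(* The first tokens leave a circulation bounded by (1 + 3 * 16) B = 49 B; both rounds together load
   a pair with at most (16 + 2 * 49) B = 114 B tokens. *)
exists (5 * 49 + 8 * (233 * 114))%N => V b B n20 B0 anti bB d3 p2.
have [tk1 [t1d t1v t1l]] := spread_tokens n20 B0 anti bB d3.
pose b1 := (b - \sum_(t <- tk1) arc t.1 t.2 *+ 3)%R.
have anti1 : antisym b1.
  by apply: antisymB => //; apply: antisym_sum => t; apply: antisymMn; apply: antisym_arc.
have d1 x : (dvg b1 x = 0)%R by rewrite dvgB t1v subrr.
have B1 x y : (`|b1 (x, y)| <= (49 * B)%:Z)%R.
  have [<-|xy] := eqVneq x y; first by rewrite antisym0.
  have -> : (b1 (x, y) = b (x, y) - (\sum_(t <- tk1) arc t.1 t.2 (x, y)) *+ 3)%R.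
    by rewrite /b1 !ffunE sum_ffunE -sumrMnl; congr (_ - _)%R; apply: eq_bigr => t _; rewrite ffunMnE.
  have := norm_sum_arcs tk1 x y; have := t1l x y xy; have := bB x y; lia.
have [tk2 [ms2 [bE [t2d m2d] t2l m2l]]] := circulation_tokens anti1 d1 B1.
have bE2 : b = (\sum_(t <- tk1 ++ tk2) arc t.1 t.2 *+ 3 + \sum_(m <- ms2) shift m)%R.
  by rewrite big_cat -addrA -bE /b1 addrC subrK.
have td : all (fun t => t.1 != t.2) (tk1 ++ tk2) by rewrite all_cat t1d.
have ev : ~~ odd (size (tk1 ++ tk2)) by apply: (token_count_even td m2d); rewrite -bE2.
have tl x y : x != y -> (pair_load (@vs2 V) (tk1 ++ tk2) x y <= 114 * B)%N.
  move=> xy; rewrite /pair_load count_cat; have := t1l x y xy; have := t2l x y xy; rewrite /pair_load; lia.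
have [|ms3 [E m3d m3l]] := cancel_tokens n20 _ td ev tl; first by lia.
exists (ms3 ++ ms2); split.
- by rewrite big_cat /= -E.
- by rewrite all_cat m3d.
- move=> x y xy; rewrite /pair_load count_cat; have := m2l x y xy; have := m3l x y xy;
  rewrite /pair_load; lia.
Qed.

(** * Quasirandom choices *)

Section Chernoff.
Variables (R : realFieldType) (V : finType) (E : {set {set V}}).
Hypothesis E3 : forall e, e \in E -> #|e| = 3.
Local Open Scope ring_scope.
Let F := {ffun {set V} -> V}.

(** The probability space: expectations are sums over this set. The values outside [E] are free. *)
Definition choices : {set F} := [set f : F | [forall e in E, f e \in e]].

Lemma choicesP (f : F) : reflect (forall e, e \in E -> f e \in e) (f \in choices).
Proof. by rewrite inE; apply: forall_inP. Qed.

Lemma choices_gt0 : (0 < #|V|)%N -> (0 < #|choices|)%N.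
Proof.
move=> /card_gt0P[x0 _]; apply/card_gt0P.
exists [ffun e : {set V} => odflt x0 [pick x in e]]; apply/choicesP => e eE; rewrite ffunE.
case: pickP => [x //|e0]; have := E3 eE; rewrite (eq_card0 e0) => //.
Qed.

Definition swap_at e (u v : V) (f : F) : F :=
  [ffun e' => if e' == e then tperm u v (f e') else f e'].

Lemma swap_atK e u v : involutive (swap_at e u v).
Proof. by move=> f; apply/ffunP=> e'; rewrite !ffunE; case: eqP => // _; rewrite tpermK. Qed.

Lemma swap_at_choices (e : {set V}) u v f : u \in e -> v \in e -> (swap_at e u v f \in choices) = (f
  \in choices).
Proof.
move=> ue ve.
have H g : g \in choices -> swap_at e u v g \in choices.
  move/choicesP=> gP; apply/choicesP=> e' e'E; rewrite ffunE; case: eqP => [Ee|_]; last exact: gP.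
  by rewrite Ee; case: tpermP => // _ _; rewrite -Ee; apply: gP.
by apply/idP/idP => [/H|/H //]; rewrite swap_atK.
Qed.

Definition ignores (S : seq {set V}) (G : F -> R) :=
  forall f g : F, (forall e, e \notin S -> f e = g e) -> G f = G g.

(* Exchanging two values at [e] is a bijection of the choices that is invisible to [G]. *)
Lemma sum_choice (e : {set V}) v G : e \in E -> v \in e -> ignores [:: e] G ->
  3 * \sum_(f in choices | f e == v) G f = \sum_(f in choices) G f.
Proof.
move=> eE ve iG; rewrite [RHS](partition_big (fun f : F => f e) (mem e)) /=;
  last by move=> f /choicesP fP; apply: fP.
rewrite [RHS](eq_bigr (fun=> \sum_(f in choices | f e == v) G f));
  first by rewrite sumr_const E3 // mulr_natl.
move=> u ue; rewrite (reindex_inj (inv_inj (swap_atK e u v))) /=; apply: eq_big => [f|f _].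
  rewrite swap_at_choices //; congr (_ && _); rewrite ffunE eqxx.
  by rewrite -[RHS](inj_eq (@perm_inj _ (tperm u v))) tpermR.
by apply: iG => e'; rewrite inE ffunE => /negbTE ->.
Qed.

(** Independence: the indicator of the prescribed values on the rest of [S] ignores the first edge
    and can be absorbed into [G]. *)
Lemma sum_choices (S : seq {set V}) (s : {set V} -> V) G : uniq S -> {in S, forall e, e \in E /\ s e \in e} ->
  ignores S G ->
  3 ^+ size S * \sum_(f in choices | all (fun e => f e == s e) S) G f = \sum_(f in choices) G f.
Proof.
elim: S G => [|e S IH] G /=; first by move=> _ _ _; rewrite mul1r; apply: eq_bigl => f; rewrite andbT.
move=> /andP[eS uS] SP iG.
have [eE se] := SP e (mem_head _ _).
have iS : ignores S G by move=> f g fg; apply: iG => e'; rewrite inE negb_or => /andP[_]; apply: fg.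
have ie : ignores [:: e] (fun f => if all (fun e => f e == s e) S then G f else 0).
  move=> f g fg; rewrite (iG f g); last first.
    by move=> e'; rewrite inE negb_or => /andP[n _]; apply: fg; rewrite inE.
  congr (if _ then _ else _); apply: eq_in_all => e' e'S; rewrite fg // inE.
  by apply: contraNneq eS => <-.
rewrite -(IH G) // => [|e' e'S]; last by apply: SP; rewrite inE e'S orbT.
rewrite exprS mulrAC mulrC; congr (_ * _).
rewrite [RHS]big_mkcondr /= -(sum_choice eE se ie); congr (_ * _).
by rewrite -[RHS]big_mkcondr; apply: eq_bigl => f; rewrite andbA.
Qed.

Section Blocks.
Variables (J : {set V}) (S : V -> seq {set V}) (s : V -> {set V} -> V) (k : nat).
Hypotheses (S_uniq : {in J, forall i, uniq (S i) /\ size (S i) = k})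
  (S_valid : {in J, forall i, {in S i, forall e, e \in E /\ s i e \in e}})
  (S_disj : {in J &, forall i j, i != j -> {in S i, forall e, e \notin S j}}).

Definition hit (f : F) i := all (fun e => f e == s i e) (S i).

(** The generating function of the number of hits. Disjoint blocks are independent, so it
    factors. *)
Lemma sum_prod_hit (c : R) (js : seq V) : uniq js -> {subset js <= J} ->
  \sum_(f in choices) \prod_(i <- js) (if hit f i then c else 1) =
  #|choices|%:R * (1 - (1 - c) / 3 ^+ k) ^+ size js.
Proof.
elim: js => [|j js IH] /=.
  by move=> _ _; under eq_bigr => f _ do rewrite big_nil; rewrite sumr_const mulr1.
move=> /andP[jjs ujs] sub; have jJ : j \in J by apply: sub; rewrite mem_head.
have subJ : {subset js <= J} by move=> i ijs; apply: sub; rewrite inE ijs orbT.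
pose G (f : F) := \prod_(i <- js) (if hit f i then c else 1).
have iG : ignores (S j) G.
  move=> f g fg; rewrite /G big_seq [RHS]big_seq; apply: eq_bigr => i ijs.
  congr (if _ then _ else _); apply: eq_in_all => e eS; rewrite fg //.
  by apply: (S_disj (subJ _ ijs) jJ) => //; apply: contraNneq jjs => <-.
have [uS sS] := S_uniq jJ.
have := sum_choices uS (S_valid jJ) iG; rewrite sS => HG.
have HG' : \sum_(f in choices | hit f j) G f = (\sum_(f in choices) G f) / 3 ^+ k.
  by rewrite -HG mulrC mulKf // expf_neq0 // pnatr_eq0.
transitivity (\sum_(f in choices) G f - (1 - c) * \sum_(f in choices | hit f j) G f).
  rewrite big_mkcondr /= mulr_sumr -sumrB; apply: eq_bigr => f _; rewrite big_cons -/(G f).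
  by case: (hit f j); ring.
by rewrite HG' (IH ujs subJ) exprS; ring.
Qed.

(** The lower-tail Chernoff bound: Markov's inequality for 1 - l raised to 3 ^ k times the number of
    hits, which is at least (1 - l) ^ (#|J| - m) on a bad choice. *)
Lemma bad_choices (l : R) (m : nat) : 0 < l -> l < 1 ->
  #|[set f in choices | (3 ^ k * #|[set i in J | hit f i]| + m <= #|J|)%N]|%:R * (1 - l) ^+ (#|J| - m) <=
  #|choices|%:R * (1 - (1 - (1 - l) ^+ (3 ^ k)) / 3 ^+ k) ^+ #|J| :> R.
Proof.
move=> l0 l1; set B := [set f in choices | _].
have l1' : 0 <= 1 - l <= 1 by lra.
have [l2 l3] := andP l1'.
have sJ : {subset enum J <= J} by move=> i; rewrite mem_enum.
have := sum_prod_hit ((1 - l) ^+ (3 ^ k)) (enum_uniq J) sJ; rewrite -cardE => <-.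
rewrite mulrC mulr_natr -sumr_const [leRHS](bigID (fun f => f \in B)) /=.
apply: (@le_trans _ _ (\sum_(f in choices | f \in B) \prod_(i <- enum J) (if hit f i then (1 - l) ^+ (3
  ^ k) else 1))); last first.
  by rewrite lerDl sumr_ge0 // => f _; rewrite prodr_ge0 // => i _; case: ifP => // _; rewrite exprn_ge0.
rewrite [leLHS](eq_bigl (fun f => (f \in choices) && (f \in B))); last first.
  by move=> f; rewrite /B [in RHS]inE andbA andbb inE.
apply: ler_sum => f /andP[_]; rewrite /B inE => /andP[_ bf].
rewrite -big_mkcond big_enum_cond /= (eq_bigl (mem [set i in J | hit f i])) => [|i]; last by rewrite !inE.
rewrite prodr_const -exprM; apply: ler_wiXn2l => //.
by move: bf; lia.
Qed.
End Blocks.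
End Chernoff.

(** * Numerical estimates for the union bound *)

Section Estimates.
Variable R : archiRealFieldType.
Local Open Scope ring_scope.

Lemma expr_1B_le (l : R) K : 0 <= l -> l <= 1 -> (1 - l) ^+ K <= 1 - K%:R * l + K%:R ^+ 2 * l ^+ 2.
Proof.
move=> l0 l1; elim: K => [|K IH]; first by rewrite expr0 mul0r expr0n /= mul0r; lra.
rewrite exprSr; apply: le_trans (ler_wpM2r _ IH) _; first by lra.
rewrite -natr1; have K0 : 0 <= K%:R :> R by []; move: K0; move: (K%:R : R) => x x0.
have : 0 <= x * l ^+ 2 by rewrite mulr_ge0 // exprn_ge0.
have : 0 <= x ^+ 2 * l ^+ 3 by rewrite mulr_ge0 // exprn_ge0.
nra.
Qed.

Lemma bernoulli_le (x : R) D : 0 <= x -> (1 + x) ^+ D * (1 - D%:R * x) <= 1.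
Proof.
move=> x0; elim: D => [|D IH]; first by rewrite expr0 mul0r; lra.
apply: le_trans IH; rewrite exprSr -mulrA ler_wpM2l ?exprn_ge0 //; first by lra.
have d0 : 0 <= D%:R :> R by []; rewrite -natr1; move: d0; move: (D%:R : R) => d d0.
have : 0 <= (d + 1) * x ^+ 2 by rewrite mulr_ge0 ?exprn_ge0 // addr_ge0.
by rewrite expr2; lra.
Qed.

(* For [l = 1 / (108 D)] the gain [(1 - l) ^ m] beats the loss [(1 + 54 l^2) ^ N] as soon as [N <= D m]. *)
Lemma chernoff_rate (D K N m : nat) (l := (108 * D%:R)^-1 : R) :
  (0 < D)%N -> (0 < K <= 27)%N -> (N <= D * m)%N -> (m <= N)%N ->
  (1 - (1 - (1 - l) ^+ K) / K%:R) ^+ N <= (1 - l) ^+ (N - m) * (1 - l / 2) ^+ m.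
Proof.
move=> D0 /andP[K0 K27] ND mN.
have D1 : 1 <= D%:R :> R by rewrite ler1n.
have lD : D%:R * l = 108^-1 by rewrite /l invfM mulrCA mulfV ?mulr1 // lt0r_neq0 //; lra.
have l0 : 0 < l by rewrite /l invr_gt0 mulr_gt0 ?ltr0n //; lra.
clearbody l.
have l1 : l <= 108^-1.
  have : 0 <= (D%:R - 1) * l by rewrite mulr_ge0 ?subr_ge0 // ltW.
  by rewrite mulrBl lD mul1r subr_ge0.
have Kr0 : 1 <= K%:R :> R by rewrite ler1n.
have Kr : K%:R <= 27 :> R by rewrite (ler_nat _ K 27).
set r := 1 - _.
have rle : r <= (1 - l) * (1 + 54 * l ^+ 2).
  have H := expr_1B_le K (ltW l0) (_ : l <= 1);
    have {}H : (1 - l) ^+ K <= 1 - K%:R * l + K%:R ^+ 2 * l ^+ 2 by apply: H; lra.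
  have : r <= 1 - l + K%:R * l ^+ 2.
    rewrite /r lerBlDr -lerBlDl ler_pdivlMr; last by lra.
    by move: H; set y := (1 - l) ^+ K; rewrite expr2; nra.
  have : 0 <= l ^+ 2 by rewrite exprn_ge0 // ltW.
  by nra.
have r0 : 0 <= r.
  have : 0 <= (1 - l) ^+ K by rewrite exprn_ge0 //; lra.
  have : (1 - l) ^+ K <= 1 by rewrite exprn_ile1 //; lra.
  set y := _ ^+ K => y1 y0; rewrite /r -/y subr_ge0 ler_pdivrMr; last by lra.
  by rewrite mul1r; lra.
apply: le_trans (lerXn2r N _ _ rle) _; rewrite ?nnegrE //.
  by rewrite mulr_ge0 //; [lra | rewrite addr_ge0 // mulr_ge0 // exprn_ge0 // ltW].
rewrite exprMn -{1}(subnK mN) exprD -mulrA ler_wpM2l ?exprn_ge0 //; first by lra.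
set x := 54 * l ^+ 2.
have x0 : 0 <= x by rewrite mulr_ge0 // exprn_ge0 // ltW.
apply: (@le_trans _ _ ((1 - l) ^+ m * (1 + x) ^+ (D * m))).
  rewrite ler_wpM2l ?exprn_ge0 //; first by lra.
  by apply: ler_weXn2l => //; lra.
rewrite exprM -exprMn; apply: lerXn2r; rewrite ?nnegrE; [|by lra|].
  by rewrite mulr_ge0 ?exprn_ge0 //; lra.
(* The choice of [l] makes D * 54 l^2 equal to l / 2. Then 1 - l <= (1 - l / 2)^2 pays for the loss
   with one factor and keeps the other. *)
have := bernoulli_le D x0; have -> : D%:R * x = l / 2.
  by rewrite /x expr2 mulrCA (mulrA D%:R) lD; field.
set y := (1 + x) ^+ D => H.
have y0 : 0 <= y by rewrite exprn_ge0 //; lra.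
have : (1 - l) * y <= (1 - l / 2) * ((1 - l / 2) * y); first by rewrite mulrA ler_wpM2r //; nra.
by move/le_trans; apply; rewrite ler_piMr //; [lra | rewrite mulrC].
Qed.

Lemma expr_decay (h : R) j : 0 < h -> h < 1 -> (1 - h) ^+ j * (1 + j%:R * h) <= 1.
Proof.
move=> h0 h1; elim: j => [|j IH]; first by rewrite expr0 mul0r; lra.
apply: le_trans IH; rewrite exprSr -mulrA ler_wpM2l ?exprn_ge0 //; first by lra.
have d0 : 0 <= j%:R :> R by []; rewrite -natr1; move: d0; move: (j%:R : R) => d d0.
have : 0 <= (d + 1) * h ^+ 2 by rewrite mulr_ge0 ?exprn_ge0 // ?addr_ge0 // ltW.
by rewrite expr2; lra.
Qed.

(** With j about a quarter of the exponent, the fourth power of (1 - h)^j <= 1 / (j h) beats the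
    cubic number of events. As n <= 7 D j, everything is compared in powers of j. *)
Lemma union_bound_small (D : nat) (h : R) : 0 < h -> h < 1 -> (0 < D)%N ->
  exists n0 : nat, forall n, (n0 <= n)%N -> (4 * n ^ 3)%N%:R * (1 - h) ^+ (n %/ D + 1) < 1.
Proof.
move=> h0 h1 D0.
have [j0 j0P] : exists j0 : nat, (4 * (7 * D) ^ 3)%N%:R / h ^+ 4 < j0%:R :> R.
  exists (Num.bound ((4 * (7 * D) ^ 3)%N%:R / h ^+ 4)); apply: archi_boundP.
  by rewrite divr_ge0 ?exprn_ge0 // ltW.
exists (4 * D * j0.+1)%N => n nP.
set m := (n %/ D + 1)%N; pose j := (m %/ 4)%N.
have jj0 : (j0 < j)%N.
  rewrite leq_divRL // /m; have : (j0.+1 * 4 <= n %/ D)%N by rewrite leq_divRL //; lia.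
  lia.
have nm : (n <= D * m)%N by rewrite /m; have := divn_eq n D; have := ltn_pmod n D0; nia.
have mj : (m <= 7 * j)%N by have := divn_eq m 4; have := ltn_pmod m (isT : (0 < 4)%N); rewrite -/j; lia.
have j4m : (j * 4 <= m)%N by apply: leq_divM.
have nb : (4 * n ^ 3 <= 4 * (7 * D) ^ 3 * j ^ 3)%N.
  rewrite -mulnA leq_mul2l /= -expnMn leq_exp2r //; nia.
have j1 : 0 < j%:R :> R by rewrite ltr0n; lia.
have pw : (1 - h) ^+ m <= (1 - h) ^+ (j * 4) by apply: ler_wiXn2l => //; lra.
have := expr_decay j h0 h1; set y := (1 - h) ^+ j => yj.
have y0 : 0 <= y by rewrite exprn_ge0 //; lra.
have yjh : y * (j%:R * h) <= 1 by nra.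
have yjh4 : y ^+ 4 * (j%:R * h) ^+ 4 <= 1.
  by rewrite -exprMn exprn_ile1 // mulr_ge0 // mulr_ge0 // ltW.
apply: (@le_lt_trans _ _ ((4 * (7 * D) ^ 3)%N%:R * j%:R ^+ 3 * y ^+ 4)).
  apply: ler_pM => //; first by rewrite exprn_ge0 //; lra.
    by rewrite -natrX -natrM ler_nat.
  by rewrite -exprM.
move: j0P; rewrite ltr_pdivrMr ?exprn_gt0 // => cP.
have jr : j0%:R < j%:R :> R by rewrite ltr_nat.
move: cP; set c := (_ : nat)%:R => cP.
have ch : c < j%:R * h ^+ 4.
  by apply: (lt_trans cP); rewrite ltr_pM2r // exprn_gt0.
have [->|yn0] := eqVneq y 0; first by rewrite expr0n mulr0 ltr01.
have yp : 0 < y by rewrite lt0r yn0.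
apply: lt_le_trans yjh4; rewrite mulrC ltr_pM2l ?exprn_gt0 //.
rewrite exprMn [X in _ < X](_ : _ = j%:R * h ^+ 4 * j%:R ^+ 3); last by ring.
by rewrite ltr_pM2r ?exprn_gt0.
by lra.
Qed.
End Estimates.

(** A family of independent events of equal probability: the event of index i asks every edge of its
    block to have the target as middle. Bundling the data lets one union bound treat families of
    different shapes. *)
Record blocks (V : finType) (E : {set {set V}}) := Blocks {
  block_ids : {set V};
  block_edges : V -> seq {set V};
  block_target : V -> {set V} -> V;
  block_size : nat;
  block_size_le : block_size <= 3;
  block_uniq : {in block_ids, forall i, uniq (block_edges i) /\ size (block_edges i) = block_size};
  block_valid : {in block_ids, forall i, {in block_edges i, forall e, e \in E /\ block_target i e \in e}};
  block_disj : {in block_ids &, forall i j, i != j -> {in block_edges i, forall e, e \notin block_edges j}}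
}.

Definition block_hits (V : finType) (E : {set {set V}}) (b : blocks E) (f : {ffun {set V} -> V}) :=
  #|[set i in block_ids b | hit (block_edges b) (block_target b) f i]|.

Lemma quasirandom_choice (R : archiRealFieldType) (D : nat) : 0 < D -> exists n0 : nat,
  forall (V : finType) (E : {set {set V}}) (I : finType) (b : I -> blocks E),
  n0 <= #|V| -> (forall e, e \in E -> #|e| = 3) -> #|I| <= 4 * #|V| ^ 3 ->
  exists2 f, f \in choices E &
    forall i, #|block_ids (b i)| <= 3 ^ block_size (b i) * block_hits (b i) f + #|V| %/ D.
Proof.
move=> D0; pose l : R := ((108 * D%:R)^-1)%R; pose h : R := (l / 2)%R.
have D1 : (1 <= D%:R :> R)%R by rewrite ler1n.
have l0 : (0 < l)%R by rewrite /l invr_gt0 mulr_gt0 ?ltr0n //; lra.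
have l1 : (l < 1)%R by rewrite invf_lt1; lra.
have h0 : (0 < h)%R by rewrite /h; lra.
have h1 : (h < 1)%R by rewrite /h; lra.
have [n1 n1P] := union_bound_small h0 h1 D0.
exists n1.+1 => V E I b nV E3 cI.
(* The [+ 1] ensures [n <= D * m]; since the negation of [Bad] is strict, the final error is still
   [n %/ D]. *)
set n := #|V| in nV *; pose m := n %/ D + 1.
pose Bad i := [set f in choices E | 3 ^ block_size (b i) * block_hits (b i) f + m <= #|block_ids (b i)|].
have badle i : (#|Bad i|%:R <= #|choices E|%:R * (1 - h) ^+ m :> R)%R.
  have [bz|[f0 f0B]] := set_0Vmem (Bad i).
    by rewrite bz cards0 mulr_ge0 // exprn_ge0 //; lra.
  have mJ : m <= #|block_ids (b i)|.
    by move: f0B; rewrite inE => /andP[_]; apply: leq_trans; rewrite leq_addl.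
  have Jn : #|block_ids (b i)| <= D * m.
    apply: leq_trans (max_card _) _; rewrite -/n /m; have := divn_eq n D; have := ltn_pmod n D0; nia.
  have K27 : 0 < 3 ^ block_size (b i) <= 27.
    by rewrite expn_gt0 /= (leq_pexp2l (m := 3) (n2 := 3)) // block_size_le.
  have := bad_choices E3 (@block_uniq _ _ (b i)) (@block_valid _ _ (b i)) (@block_disj _ _ (b i)) m l0 l1.
  have := chernoff_rate R D0 K27 Jn mJ; rewrite -/l -/h natrX => rate bad.
  have := le_trans bad (ler_wpM2l (ler0n R _) rate).
  rewrite mulrCA [(_ * ((1 - l) ^+ _))%R]mulrC ler_pM2l // exprn_gt0 //; lra.
have ch0 : 0 < #|choices E| by apply: choices_gt0 => //; lia.
have /subsetPn[f fc fB] : ~~ (choices E \subset \bigcup_i Bad i).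
  apply/negP=> /subset_leq_card; rewrite leqNgt => /negP[].
  apply: (@leq_ltn_trans (\sum_i #|Bad i|)).
    elim/big_rec2: _ => [|i A k _ IH]; first by rewrite cards0.
    by apply: leq_trans (leq_card_setU _ _) _; rewrite leq_add2l.
  rewrite -(ltr_nat R) natr_sum; apply: le_lt_trans (ler_sum _ (fun i _ => badle i)) _.
  rewrite sumr_const -[X in (X < _)%R]mulr_natl mulrCA gtr_pMr ?ltr0n //.
  apply: le_lt_trans (n1P n _); last by lia.
  by rewrite ler_wpM2r ?ler_nat // exprn_ge0 //; lra.
exists f => // i; rewrite leqNgt; apply: contra fB => lt.
by apply/bigcupP; exists i => //; rewrite inE fc /m addnA addn1.
Qed.

(** * Realising shifts inside the hypergraph *)

Section Imbalance.
Variables (V : finType) (H : graph3 V).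
Local Notation E := (edges H).
Local Open Scope ring_scope.
Let A := {ffun V * V -> int}.
Let F := {ffun {set V} -> V}.

Definition spokes (e : {set V}) (v : V) : A := \sum_(w in e) arc v w.
Definition imbalance (f : F) : A := \sum_(e in E) spokes e (f e).

Lemma big_tri (M : nmodType) (G : V -> M) x y z : x != y -> y != z -> x != z ->
  \sum_(w in tri x y z) G w = G x + G y + G z.
Proof.
move=> xy yz xz; rewrite /tri setUC big_setU1; last by rewrite !inE negb_or !(eq_sym z) xz yz.
by rewrite big_setU1 ?inE // big_set1 addrC.
Qed.

Lemma edge_tri e v : e \in E -> v \in e -> exists a b, [/\ e = tri v a b, v != a, a != b & v != b].
Proof.
move=> eE ve; have e3 := card_edge eE.
have /set0Pn[a] : e :\ v != set0 by rewrite -card_gt0; have := cardsD1 v e; rewrite ve e3; lia.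
rewrite !inE => /andP[av ae]; rewrite eq_sym in av.
have [b eb] := triP e3 ve ae av; exists a, b.
by have [] := @card_tri _ v a b; rewrite -?eb.
Qed.

Lemma spokes_tri e v a b : e = tri v a b -> v != a -> a != b -> v != b ->
  spokes e v = arc v a + arc v b.
Proof. by move=> -> va ab vb; rewrite /spokes big_tri // arcpp add0r. Qed.

Lemma in_tri (e : {set V}) v a b x : e = tri v a b -> (x \in e) = [|| x == v, x == a | x == b].
Proof. by move=> ->; rewrite !inE orbA. Qed.

Lemma antisym_imbalance f : antisym (imbalance f).
Proof.
rewrite /imbalance -big_enum /=; apply: antisym_sum => e.
by rewrite /spokes -big_enum /=; apply: antisym_sum => w; apply: antisym_arc.
Qed.

(** The spokes of an edge have divergence 2 at the middle and -1 at the other two vertices: 3 at the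
    middle, minus 1 at each vertex of the edge. *)
Lemma dvg_imbalance f x : f \in choices E ->
  dvg (imbalance f) x = #|[set e in E | f e == x]|%:Z * 3 - (degree H x)%:Z.
Proof.
move=> /choicesP fP; rewrite dvg_sum.
rewrite (eq_bigr (fun e => (f e == x)%:Z * 3 - (x \in e)%:Z)); last first.
  move=> e eE; have [a [b [ee va ab vb]]] := edge_tri eE (fP e eE).
  rewrite (spokes_tri ee) // dvgD !dvg_arc (in_tri _ ee) (eq_sym (f e)).
  have d u v : u != v -> ~~ ((x == u) && (x == v)) by apply: contra => /andP[/eqP <- /eqP <-].
  move: (d _ _ va) (d _ _ ab) (d _ _ vb).
  by case: (x == f e); case: (x == a); case: (x == b).
have cE (Q : pred {set V}) : \sum_(e in E) (Q e)%:Z = #|[set e in E | Q e]|%:Z.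
  rewrite -sum1_card sum_Posz [RHS](eq_bigl (fun e => (e \in E) && Q e)); last by move=> e; rewrite inE.
  by rewrite [RHS]big_mkcondr; apply: eq_bigr => e _; case: (Q e).
by rewrite sumrB -mulr_suml (cE (fun e => f e == x)) (cE (fun e => x \in e)).
Qed.

Lemma par_imbalance f : f \in choices E -> exists c : int, par (imbalance f) = c * 2.
Proof.
move=> /choicesP fP; rewrite par_sum -big_enum /=.
have : {subset enum E <= E} by move=> e; rewrite mem_enum.
elim: (enum E) => [|e s IH] sub; first by exists 0; rewrite big_nil.
have [|c Ec] := IH; first by move=> u us; apply: sub; rewrite inE us orbT.
have eE : e \in E by apply: sub; rewrite mem_head.
have [a [b [ee va ab vb]]] := edge_tri eE (fP e eE).
rewrite big_cons Ec (spokes_tri ee) // parD.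
by case: (par_arc va) => ->; case: (par_arc vb) => ->;
  [exists (c + 1)|exists c|exists c|exists (c - 1)]; ring.
Qed.

Lemma imbalanceE (f : F) x y : f \in choices E -> x != y ->
  imbalance f (x, y) = (mid_count H f x y)%:Z - (mid_count H f y x)%:Z.
Proof.
move=> /choicesP fP xy; rewrite sum_ffunE.
have cE (Q : pred {set V}) : #|[set e in E | Q e]|%:Z = \sum_(e in E) (Q e)%:Z.
  rewrite -sum1_card sum_Posz (eq_bigl (fun e => (e \in E) && Q e)); last by move=> e; rewrite inE.
  by rewrite big_mkcondr; apply: eq_bigr => e _; case: (Q e).
rewrite /mid_count (cE (fun e => [&& x \in e, y \in e & f e == x])) (cE (fun e => [&& y \in e, x \in e
  & f e == y])) -sumrB.
apply: eq_bigr => e eE; have [a [b [ee va ab vb]]] := edge_tri eE (fP e eE).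
rewrite (spokes_tri ee) // !ffunE !xpair_eqE !(in_tri _ ee).
rewrite !(eq_sym (f e)).
have d u v : u != v -> ~~ ((x == u) && (x == v)) /\ ~~ ((y == u) && (y == v)).
  by move=> uv; split; apply: contra uv => /andP[/eqP <- /eqP <-].
have d' u : ~~ ((x == u) && (y == u)) by apply: contra xy => /andP[/eqP -> /eqP ->].
have [d1 d2] := d _ _ va; have [d3 d4] := d _ _ ab; have [d5 d6] := d _ _ vb.
move: d1 d2 d3 d4 d5 d6 (d' (f e)) (d' a) (d' b).
by case: (x == f e); case: (y == f e); case: (x == a); case: (y == a); case: (x == b); case: (y == b).
Qed.

Lemma imbalance0_balanced f : f \in choices E -> imbalance f = 0 ->
  forall x y, x != y -> mid_count H f x y = mid_count H f y x.
Proof.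
move=> fc b0 x y xy; apply/eqP; rewrite -eqz_nat -subr_eq0 -imbalanceE // b0 ffunE //.
Qed.

Definition set_mid (f : F) e v : F := [ffun e' => if e' == e then v else f e'].

Lemma imbalance_set_mid f e v : e \in E ->
  imbalance (set_mid f e v) = imbalance f + (spokes e v - spokes e (f e)).
Proof.
move=> eE; rewrite /imbalance (bigD1 e) // [in RHS](bigD1 e) //= ffunE eqxx.
rewrite (eq_bigr (fun e => spokes e (f e))) => [|e' /andP[_ /negbTE n]]; last by rewrite ffunE n.
by rewrite [RHS]addrC addrA subrK.
Qed.

Lemma set_mid_choices f (e : {set V}) v : f \in choices E -> v \in e -> set_mid f e v \in choices E.
Proof.
move=> /choicesP fP ve; apply/choicesP => e' e'E; rewrite ffunE.
by case: eqP => [->|_]; [exact: ve | exact: fP].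
Qed.

(* The three edges through the apex act as a virtual edge on {x, y, z} contributing -t_z; after the
   change they contribute -t_x, and the pairs at the apex are unaffected. *)
Definition apex (m : V * V * V) (a : V) : seq {set V} :=
  [:: tri a m.1.2 m.2; tri a m.2 m.1.1; tri a m.1.1 m.1.2].
Definition apex_target (m : V * V * V) a (e : {set V}) :=
  if e == tri a m.1.2 m.2 then a else if e == tri a m.2 m.1.1 then m.2 else m.1.2.

Lemma apex_uniq m a : uniq (vs3 m) -> a \notin vs3 m -> uniq (apex m a).
Proof.
case: m => [[z x] y]; rewrite /vs3 /apex /= !inE !negb_or => /and3P[/andP[zx zy] xy _] /and3P[az ax ay].
rewrite andbT; apply/andP; split; first apply/andP; first split.
- apply/eqP=> /setP/(_ x);
  rewrite !inE !eqxx orbT (eq_sym x a) (eq_sym x z) (negbTE ax) (negbTE xy) (negbTE zx) //.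
- apply/eqP=> /setP/(_ y);
  rewrite !inE !eqxx !orbT (eq_sym y a) (eq_sym y z) (eq_sym y x) (negbTE ay) (negbTE xy) (negbTE zy) //.
- apply/eqP=> /setP/(_ y);
  rewrite !inE !eqxx !orbT (eq_sym y a) (eq_sym y z) (eq_sym y x) (negbTE ay) (negbTE xy) (negbTE zy) //.
Qed.

Lemma apex_notin m a : uniq (vs3 m) -> {subset apex m a <= E} -> a \notin vs3 m.
Proof.
case: m => [[z x] y] _ sub; rewrite /vs3 !inE !negb_or /=.
have [ax _ ay] := card_tri (card_edge (sub (tri a x y) (mem_head _ _))).
have [|_ _ az] := @card_tri _ a y z; first by apply/card_edge/sub; rewrite !inE eqxx orbT.
by rewrite ax ay az.
Qed.

Lemma apex_shift f m a : f \in choices E -> uniq (vs3 m) -> {subset apex m a <= E} ->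
  all (fun e => f e == apex_target m a e) (apex m a) ->
  exists f', [/\ f' \in choices E, imbalance f' = imbalance f + shift m &
    forall e, e \notin apex m a -> f' e = f e].
Proof.
move=> fc um sub; have am := apex_notin um sub; have ua := apex_uniq um am.
move: m um sub am ua => [[z x] y]; rewrite /apex_target /apex /vs3 /= !inE !negb_or.
move=> /and3P[/andP[zx zy] xy _] sub /and3P[az ax ay] /and3P[/andP[n12 n13] n23 _].
rewrite eqxx ![_ == tri a x y]eq_sym (negbTE n12) (negbTE n13) eqxx (eq_sym _ (tri a y z)) (negbTE n23) andbT.
case/and3P=> /eqP f1 /eqP f2 /eqP f3.
have e1 : tri a x y \in E by apply: sub; rewrite !inE eqxx.
have e2 : tri a y z \in E by apply: sub; rewrite !inE eqxx orbT.
have e3 : tri a z x \in E by apply: sub; rewrite !inE eqxx !orbT.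
(* The middles a, y, x become y, a, z; the arcs at a cancel both before and after. *)
exists (set_mid (set_mid (set_mid f (tri a x y) y) (tri a y z) a) (tri a z x) z); split.
- by do 3![apply: set_mid_choices; last by rewrite !inE eqxx ?orbT].
- rewrite !imbalance_set_mid // !ffunE ![tri a z x == _]eq_sym (negbTE n13) (negbTE n23) eq_sym (negbTE
  n12) f1 f2 f3.
  have xz : x != z by rewrite eq_sym. have yz : y != z by rewrite eq_sym.
  rewrite /spokes !big_tri // /shift /= !arcpp.
  rewrite (arcN a x) (arcN a y) (arcN a z) (arcN z x) (arcN z y).
  by apply/ffunP=> u; rewrite !(ffunE, ffunMnE); ring.
- move=> e; rewrite !inE !negb_or => /and3P[/negbTE g1 /negbTE g2 /negbTE g3].
  by rewrite !ffunE g1 g2 g3.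
Qed.
End Imbalance.

(** * Choosing the apexes greedily *)

Section ApexGreedy.
Variables (V : finType) (H : graph3 V).
Local Notation n := #|V|.
Local Notation E := (edges H).
Let F := {ffun {set V} -> V}.
Let move := (V * V * V)%type.

Definition used (hs : seq (move * V)) := flatten [seq apex h.1 h.2 | h <- hs].

Lemma used_cons h hs : used (h :: hs) = apex h.1 h.2 ++ used hs.
Proof. by []. Qed.

(** An edge used by a change consists of the apex and two vertices of the triple. Either x and y
    both lie in the triple and a is the apex, or one of them is the apex, the other lies in the
    triple and a is one of its two remaining vertices. *)
Lemma card_apex_through (h : move * V) x y : x != y -> {subset apex h.1 h.2 <= E} -> uniq (vs3 h.1) ->
  #|[set a | tri a x y \in apex h.1 h.2]| <=
  ((x \in vs3 h.1) && (y \in vs3 h.1)) + 2 * ((x \in vs3 h.1) && (h.2 == y)) + 2 * ((y \in vs3 h.1) &&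
    (h.2 == x)).
Proof.
case: h => m c /= xy sub um; have cm := apex_notin um sub.
have inS a : tri a x y \in apex m c ->
  [/\ c \in tri a x y, {subset tri a x y <= c :: vs3 m}, a != x & a != y].
  move=> ax; have [ne _ ne'] := card_tri (card_edge (sub _ ax)); split=> //; move: ax;
    rewrite /apex !in_cons in_nil orbF.
    by case/or3P=> /eqP ->; rewrite !inE eqxx.
  by case/or3P=> /eqP -> w; rewrite !inE => /orP[/orP[]|] /eqP ->; rewrite eqxx ?orbT.
have small (S : {set V}) u : u \in vs3 m -> {subset S <= [seq w <- vs3 m | w != u]} -> #|S| <= 2.
  move=> um' sS; apply: (@leq_trans (size [seq w <- vs3 m | w != u])).
    by rewrite cardE; apply: uniq_leq_size; [exact: enum_uniq | move=> w; rewrite mem_enum; apply: sS].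
  have sz : count (pred1 u) (vs3 m) + count (predC (pred1 u)) (vs3 m) = 3 := count_predC _ _.
  have : 0 < count (pred1 u) (vs3 m) by rewrite -has_count has_pred1.
  rewrite size_filter (_ : count (fun w => w != u) _ = count (predC (pred1 u)) (vs3 m)) //.
  by move: sz; move: (count (pred1 u) _) (count (predC _) _) => i j; lia.
case: (c =P x) => [cx|/eqP cx]; last case: (c =P y) => [cy|/eqP cy].
- have xm : x \notin vs3 m by rewrite -cx.
  rewrite (negbTE xm) /= andbT; case: (boolP (y \in vs3 m)) => ym; last first.
    rewrite leqn0 cards_eq0; apply/eqP/setP=> a; rewrite in_set0 in_set; apply/negP=> /inS[_ s _ _].
    have : y \in c :: vs3 m by apply: s; rewrite !inE eqxx orbT.
    by rewrite in_cons (negbTE ym) orbF cx eq_sym (negbTE xy).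
  rewrite muln1 addnC; apply: leq_trans (leq_addr _ _); apply: (small _ y) => // a;
    rewrite in_set => /inS[_ s ax ay].
  rewrite mem_filter ay; have : a \in c :: vs3 m by apply: s; rewrite !inE eqxx.
  by rewrite in_cons cx (negbTE ax).
- have ym : y \notin vs3 m by rewrite -cy.
  rewrite (negbTE ym) /= andbF andbT; case: (boolP (x \in vs3 m)) => xm; last first.
    rewrite leqn0 cards_eq0; apply/eqP/setP=> a; rewrite in_set0 in_set; apply/negP=> /inS[_ s _ _].
    have : x \in c :: vs3 m by apply: s; rewrite !inE eqxx orbT.
    by rewrite in_cons (negbTE xm) orbF cy (negbTE xy).
  rewrite muln1 addn0; apply: (small _ x) => // a; rewrite in_set => /inS[_ s ax ay].
  rewrite mem_filter ax; have : a \in c :: vs3 m by apply: s; rewrite !inE eqxx.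
  by rewrite in_cons cy (negbTE ay).
- rewrite !andbF !addn0.
  case: (boolP ((x \in vs3 m) && (y \in vs3 m))) => xym.
    rewrite -[leqRHS]/1 -(cards1 c); apply/subset_leq_card/subsetP=> a; rewrite in_set => /inS[ca _ _ _].
    by move: ca; rewrite !inE (negbTE cx) (negbTE cy) !orbF eq_sym.
  rewrite leqn0 cards_eq0; apply/eqP/setP=> a; rewrite in_set0 in_set; apply/negP=> /inS[_ s _ _].
  case/negP: xym; have : x \in c :: vs3 m by apply: s; rewrite !inE eqxx orbT.
  have : y \in c :: vs3 m by apply: s; rewrite !inE eqxx orbT.
  by rewrite !in_cons ![_ == c]eq_sym (negbTE cx) (negbTE cy) /= => -> ->.
Qed.

Definition realized (hs : seq (move * V)) (L : nat) :=
  [/\ {in hs, forall h, uniq (vs3 h.1) /\ {subset apex h.1 h.2 <= E}} &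
   forall v w, count (fun h => (v \in vs3 h.1) && (h.2 == w)) hs <= L].

(** Few edges change at each pair. This keeps apexes available during the greedy choice and lets the
    links survive it. *)
Lemma card_used_through hs L P x y : realized hs L -> x != y ->
  pair_load (@vs3 V) (map fst hs) x y <= P ->
  #|[set a | tri a x y \in used hs]| <= P + 4 * L.
Proof.
move=> [hsP hsL] xy hP.
apply: (@leq_trans (\sum_(h <- hs) #|[set a | tri a x y \in apex h.1 h.2]|)).
  elim: hs {hsP hsL hP} => [|h hs IH]; first by rewrite big_nil eq_card0 // => a; rewrite inE.
  rewrite big_cons used_cons; apply: leq_trans (leq_add (leqnn _) IH); apply: leq_trans (leq_card_setU _ _).
  by apply/subset_leq_card/subsetP=> a; rewrite !in_set mem_cat.
rewrite big_seq; apply: leq_trans (leq_sum _ (fun h hh => card_apex_through xy (hsP h hh).2 (hsP h hh).1)) _.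
rewrite -big_seq !big_split /= !big1_eq !addn0.
have cE (Q : pred (move * V)) : \sum_(z <- hs) Q z = count Q hs.
  by rewrite -sum1_count [RHS]big_mkcond; apply: eq_bigr => z _; case: (Q z).
rewrite (cE (fun h => (x \in vs3 h.1) && (y \in vs3 h.1))) (cE (fun h => (x \in vs3 h.1) && (h.2 == y)))
  (cE (fun h => (y \in vs3 h.1) && (h.2 == x))).
move: hP; rewrite /pair_load count_map => hP.
apply: (@leq_trans (P + (L + L) + (L + L))); last by lia.
by rewrite !leq_add.
Qed.

Definition ready (m : move) (f : F) a :=
  all (fun e => e \in E) (apex m a) && all (fun e => f e == apex_target m a e) (apex m a).

(** An apex ready for [f0] stays ready as long as its three edges are untouched. For each pair of
    the triple at most [P + 4 * L] apexes are lost to changed edges; for each vertex at most [r] are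
    lost to the cap [L]. *)
Lemma realize_shifts (f0 : F) (ms : seq move) P L r : f0 \in choices E -> 0 < L -> n * P <= L * r ->
  all (fun m => uniq (vs3 m)) ms ->
  (forall x y, x != y -> pair_load (@vs3 V) ms x y <= P) ->
  (forall m, uniq (vs3 m) -> 3 * (P + 4 * L) + 3 * r < #|[set a | ready m f0 a]|) ->
  exists hs f, [/\ map fst hs = ms, realized hs L,
    f \in choices E /\ (forall e, e \notin used hs -> f e = f0 e) &
    imbalance H f = (imbalance H f0 + \sum_(m <- ms) shift m)%R].
Proof.
move=> f0c L0 PL um pl good.
elim: ms um pl => [|m ms IH] /=.
  move=> _ _; exists [::], f0; split; [by [] | by split | by split | by rewrite big_nil addr0].
move=> /andP[um ums] pl.
have pl' x y : x != y -> pair_load (@vs3 V) ms x y <= P.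
  by move=> xy; apply: leq_trans (pl x y xy); rewrite leq_addl.
have [hs [f [hsE hsR [fc ff0] fb]]] := IH ums pl'.
have [hsP hsL] := hsR.
have vl v : count (fun m => v \in vs3 m) ms <= n * P.
  apply: vertex_load => [u ui|w wv]; last by apply: pl'; rewrite eq_sym.
  have := allP ums u ui; case: u {ui} => [[z x] y];
    rewrite /vs3 /= !inE !negb_or => /and3P[/andP[zx zy] xy _].
  case/or3P=> /eqP ->; [exists x | exists z | exists z]; rewrite ?inE ?eqxx ?orbT //; by rewrite eq_sym.
pose S1 := [set a | tri a m.1.2 m.2 \in used hs].
pose S2 := [set a | tri a m.2 m.1.1 \in used hs].
pose S3 := [set a | tri a m.1.1 m.1.2 \in used hs].
pose S4 := \bigcup_(v <- vs3 m) [set a | L <= count (fun h : move * V => (v \in vs3 h.1) && (h.2 == a)) hs].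
have mne : [/\ m.1.1 != m.1.2, m.1.2 != m.2 & m.2 != m.1.1].
  by move: um; rewrite /vs3 /= !inE !negb_or (eq_sym m.2) => /and3P[/andP[-> ->] -> _].
have [m1 m2 m3] := mne.
have c1 : #|S1| <= P + 4 * L by apply: card_used_through => //; rewrite hsE pl'.
have c2 : #|S2| <= P + 4 * L by apply: card_used_through => //; rewrite hsE pl'.
have c3 : #|S3| <= P + 4 * L by apply: card_used_through => //; rewrite hsE pl'.
have c4 : #|S4| <= 3 * r.
  rewrite -[3]/(size (vs3 m)); apply: card_bigcup_leq => v _; apply: card_overloaded => //.
  by apply: leq_trans PL; apply: leq_trans (vl v); rewrite -hsE count_map.
have /subsetPn[a] : ~~ ([set a | ready m f0 a] \subset S1 :|: S2 :|: S3 :|: S4).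
  apply/negP=> /subset_leq_card; rewrite leqNgt => /negP[]; apply: leq_ltn_trans (good m um).
  apply: leq_trans (leq_card_setU _ _) _; rewrite leq_add //.
  rewrite (_ : 3 * (P + 4 * L) = P + 4 * L + (P + 4 * L) + (P + 4 * L));
    last by rewrite mulSn mul2n -addnn addnA.
  apply: leq_trans (leq_card_setU _ _) _; rewrite leq_add //.
  by apply: leq_trans (leq_card_setU _ _) _; rewrite leq_add.
rewrite !in_setU !negb_or !(in_set (fun a => _)) => /andP[aE aT] /andP[/andP[/andP[a1 a2] a3] a4].
have sub : {subset apex m a <= E} by exact/allP.
have aU : {in apex m a, forall e, e \notin used hs}.
  by move=> e; rewrite !inE => /or3P[] /eqP ->.
have aT' : all (fun e => f e == apex_target m a e) (apex m a).
  by apply/allP=> e ea; rewrite ff0 ?aU //; apply: (allP aT).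
have [f' [f'c f'b f'E]] := apex_shift fc um sub aT'.
exists ((m, a) :: hs), f'; split=> /=.
- by rewrite hsE.
- split; first by move=> h; rewrite inE => /orP[/eqP -> //|]; apply: hsP.
  move=> v w /=; case: (boolP (v \in vs3 m)) => vm /=; last exact: hsL.
  case: (a =P w) => [<-|_]; last exact: hsL.
  rewrite ltnNge; apply: contra a4 => le; rewrite /S4 bigcup_seq; apply/bigcupP; exists v => //.
  by rewrite inE.
- split=> // e; rewrite used_cons mem_cat negb_or => /andP[e1 e2].
  by rewrite f'E // ff0.
- by rewrite f'b fb big_cons -addrA [X in (_ + X)%R]addrC.
Qed.
End ApexGreedy.

(** * Neighbourhoods of pairs and codegrees *)

Section Neighbourhoods.
Variables (V : finType) (H : graph3 V).
Local Notation n := #|V|.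
Local Notation E := (edges H).

Definition nbrs x y := [set z | tri x y z \in E].

Lemma card_edges_through (Q : pred {set V}) x y : x != y ->
  #|[set e in E | [&& x \in e, y \in e & Q e]]| = #|[set z in nbrs x y | Q (tri x y z)]|.
Proof.
move=> xy; rewrite -(@card_in_imset _ _ (tri x y)); last first.
  move=> z w; rewrite !inE => /andP[zE _] _ /setP/(_ z).
  have [_ yz xz] := card_tri (card_edge zE).
  by rewrite !inE eqxx orbT (eq_sym z x) (eq_sym z y) (negbTE xz) (negbTE yz) /= => /esym/eqP.
apply: eq_card => e; rewrite inE; apply/and4P/imsetP.
  case=> eE xe ye Qe; have [z ez] := triP (card_edge eE) xe ye xy.
  by exists z; rewrite // !inE -ez eE.
by case=> z; rewrite !inE => /andP[zE Qz] ->; rewrite zE Qz !inE !eqxx !orbT.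
Qed.

Lemma codegreeE x y : x != y -> codegree H x y = #|nbrs x y|.
Proof.
move=> xy; have := card_edges_through predT xy.
rewrite (_ : [set z in nbrs x y | _] = nbrs x y); last by apply/setP=> z; rewrite !inE andbT.
by move=> <-; apply: eq_card => e; rewrite !inE !andbT.
Qed.

Lemma min_codegree_le x y : x != y -> min_codegree H <= codegree H x y.
Proof.
move=> xy; rewrite /min_codegree.
have : (x, y) \in index_enum (V * V)%type by rewrite mem_index_enum.
elim: (index_enum _) => // p s IH; rewrite inE big_cons => /orP[/eqP <-|/IH le].
  by rewrite /= xy geq_minl.
by case: ifP => // _; apply: leq_trans (geq_minr _ _) le.
Qed.

Lemma card_setI_ge (A B : {set V}) : #|A| + #|B| <= #|A :&: B| + n.
Proof. by rewrite -cardsUI addnC leq_add2l max_card. Qed.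
End Neighbourhoods.

(** * The families of independent events *)

Section BlockSystems.
Variables (V : finType) (H : graph3 V).
Local Notation E := (edges H).

Section Build.
Variables (base : seq V) (ids : {set V}) (es : V -> seq {set V}) (tg : V -> {set V} -> V) (k : nat).
Hypotheses (k3 : k <= 3)
  (esU : {in ids, forall i, uniq (es i) /\ size (es i) = k})
  (esV : {in ids, forall i, {in es i, forall e, e \in E /\ tg i e \in e}})
  (esb : forall i e, e \in es i -> i \in e /\ {subset e <= i :: base})
  (idb : {in ids, forall i, i \notin base}).

(** Every edge of block i contains i, whereas the edges of block j lie in [j :: base]. *)
Lemma star_disj : {in ids &, forall i j, i != j -> {in es i, forall e, e \notin es j}}.
Proof.
move=> i j iI jI ij e ei; apply/negP=> /esb[_ sub]; have [/sub + _] := esb ei.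
by rewrite inE (negbTE ij) (negbTE (idb iI)).
Qed.

Definition star_blocks : blocks E := Blocks k3 esU esV star_disj.
End Build.

Lemma mid_blocks x y (tg : V -> V) : x != y -> (forall z, tg z \in tri x y z) ->
  {b : blocks E | [/\ block_ids b = nbrs H x y, block_size b = 1 &
    forall f : {ffun {set V} -> V}, block_hits b f = #|[set z in nbrs H x y | f (tri x y z) == tg z]|]}.
Proof.
move=> xy tgP.
have H1 : {in nbrs H x y, forall z, uniq [:: tri x y z] /\ size [:: tri x y z] = 1} by [].
have H2 : {in nbrs H x y, forall z, {in [:: tri x y z], forall e, e \in E /\ tg z \in e}}.
  by move=> z; rewrite inE => zE e; rewrite inE => /eqP ->.
have H3 z e : e \in [:: tri x y z] -> z \in e /\ {subset e <= [:: z; x; y]}.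
  rewrite inE => /eqP ->; split; first by rewrite !inE eqxx orbT.
  by move=> w; rewrite !inE => /orP[/orP[]|] ->; rewrite ?orbT.
have H4 : {in nbrs H x y, forall z, z \notin [:: x; y]}.
  move=> z; rewrite in_set => zE; have [_ yz xz] := card_tri (card_edge zE);
    by rewrite !inE negb_or !(eq_sym z) xz yz.
exists (@star_blocks [:: x; y] (nbrs H x y) (fun z => [:: tri x y z]) (fun z _ => tg z) 1 isT H1 H2 H3 H4).
split=> // f; rewrite /block_hits /hit /=; apply: eq_card => z; rewrite [in LHS]inE [in RHS]inE /=.
by rewrite andbT.
Qed.

Lemma link_blocks x x' y : x != y -> x' != y -> x != x' ->
  {b : blocks E | [/\ block_ids b = nbrs H x y :&: nbrs H x' y, block_size b = 2 &
    forall f : {ffun {set V} -> V}, block_hits b f =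
      #|[set z in nbrs H x y :&: nbrs H x' y | (f (tri x y z) == y) && (f (tri x' y z) == y)]|]}.
Proof.
move=> xy x'y xx'; set I := _ :&: _.
have inI z : z \in I -> [/\ tri x y z \in E, tri x' y z \in E & [/\ x != z, x' != z & y != z]].
  rewrite !inE => /andP[z1 z2]; have [_ yz xz] := card_tri (card_edge z1).
  by have [_ _ x'z] := card_tri (card_edge z2).
have H1 : {in I, forall z, uniq [:: tri x y z; tri x' y z] /\ size [:: tri x y z; tri x' y z] = 2}.
  move=> z /inI[_ _ [xz _ _]]; split=> //; rewrite /= inE andbT; apply/eqP=> /setP/(_ x).
  by rewrite !inE eqxx (negbTE xx') (negbTE xy) (negbTE xz).
have H2 : {in I, forall z, {in [:: tri x y z; tri x' y z], forall e, e \in E /\ y \in e}}.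
  by move=> z /inI[e1 e2 _] e; rewrite !inE => /orP[] /eqP ->; split=> //; rewrite !inE eqxx orbT.
have H3 z e : e \in [:: tri x y z; tri x' y z] -> z \in e /\ {subset e <= [:: z; x; x'; y]}.
  rewrite !inE => /orP[] /eqP ->; (split; first by rewrite !inE eqxx orbT);
  by move=> w; rewrite !inE => /orP[/orP[]|] ->; rewrite ?orbT.
have H4 : {in I, forall z, z \notin [:: x; x'; y]}.
  by move=> z /inI[_ _ [a b c]]; rewrite !inE !negb_or !(eq_sym z) a b c.
exists (@star_blocks [:: x; x'; y] I (fun z => [:: tri x y z; tri x' y z]) (fun _ _ => y) 2 isT H1 H2 H3 H4).
split=> // f; rewrite /block_hits /hit /=; apply: eq_card => z; rewrite [in LHS]inE [in RHS]inE /=.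
by rewrite andbT.
Qed.

Definition apexes (m : V * V * V) := [set a | all (fun e => e \in E) (apex m a)].

Lemma apex_blocks m : uniq (vs3 m) ->
  {b : blocks E | [/\ block_ids b = apexes m, block_size b = 3 &
    forall f : {ffun {set V} -> V}, block_hits b f = #|[set a | ready H m f a]|]}.
Proof.
move=> um.
have inI a : a \in apexes m -> {subset apex m a <= E} by rewrite inE => /allP.
have H1 : {in apexes m, forall a, uniq (apex m a) /\ size (apex m a) = 3}.
  by move=> a /inI sub; split=> //; apply: apex_uniq => //; apply: apex_notin sub.
have H2 : {in apexes m, forall a, {in apex m a, forall e, e \in E /\ apex_target m a e \in e}}.
  move=> a /inI sub e ea; split; first exact: sub.
  move: ea; rewrite /apex_target /apex !in_cons in_nil orbF.
  case: eqP => [-> _|_ /=]; first by rewrite !inE eqxx.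
  by case: eqP => [-> _|_ /= /eqP ->]; rewrite !inE eqxx ?orbT.
have H3 a e : e \in apex m a -> a \in e /\ {subset e <= a :: vs3 m}.
  rewrite /apex !in_cons in_nil orbF => /or3P[] /eqP ->; (split; first by rewrite !inE eqxx);
  by move=> w; rewrite !inE => /orP[/orP[]|] ->; rewrite ?orbT.
have H4 : {in apexes m, forall a, a \notin vs3 m} by move=> a /inI; apply: apex_notin.
exists (@star_blocks (vs3 m) (apexes m) (apex m) (apex_target m) 3 isT H1 H2 H3 H4).
split=> // f; rewrite /block_hits /hit /=; apply: eq_card => a; rewrite [in LHS]inE [in RHS]inE.
by rewrite /ready [in LHS]inE.
Qed.

(** Filler for indices with coinciding vertices, so that the index type can be a full product. *)
Lemma no_blocks : blocks E.
Proof.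
by apply: (@Blocks _ _ set0 (fun=> [::]) (fun v _ => v) 0) => // i; rewrite inE.
Qed.
End BlockSystems.

(** * The theorem *)

Lemma quasirandom_mid (R : archiRealFieldType) D : 0 < D -> exists n0 : nat,
  forall (V : finType) (H : graph3 V), n0 <= #|V| ->
  exists2 f, f \in choices (edges H) & [/\
    forall x y, (`|imbalance H f (x, y)| <= (#|V| %/ D)%:Z)%R,
    forall m, uniq (vs3 m) -> #|apexes H m| <= 27 * #|[set a | ready H m f a]| + #|V| %/ D &
    forall x x' y, x != y -> x' != y -> x != x' ->
      #|nbrs H x y :&: nbrs H x' y| <= 9 * #|[set z in nbrs H x y :&: nbrs H x' y |
        (f (tri x y z) == y) && (f (tri x' y z) == y)]| + #|V| %/ D].
Proof.
move=> D0; have [n0 n0P] := quasirandom_choice R D0; exists n0 => V H nV.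
(* Two bits name the kind of event: x as the middle of {x, y, z}, z as the middle, links, apexes.
   This makes 4 n^3 indices. *)
pose I : finType := ((bool * bool) * (V * V * V))%type.
pose mid_spec x y tg (b : blocks (edges H)) := [/\ block_ids b = nbrs H x y, block_size b = 1 &
    forall f : {ffun {set V} -> V}, block_hits b f = #|[set z in nbrs H x y | f (tri x y z) == tg z]|].
pose link_spec x x' y (b : blocks (edges H)) := [/\ block_ids b = nbrs H x y :&: nbrs H x' y,
  block_size b = 2 &
    forall f : {ffun {set V} -> V}, block_hits b f =
      #|[set z in nbrs H x y :&: nbrs H x' y | (f (tri x y z) == y) && (f (tri x' y z) == y)]|].
pose apex_spec m (b : blocks (edges H)) := [/\ block_ids b = apexes H m, block_size b = 3 &
    forall f : {ffun {set V} -> V}, block_hits b f = #|[set a | ready H m f a]|].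
pose spec (i : I) b :=
  [/\ i.1 = (false, false) -> i.2.1.1 != i.2.1.2 -> mid_spec i.2.1.1 i.2.1.2 (fun=> i.2.1.1) b,
    i.1 = (false, true) -> i.2.1.1 != i.2.1.2 -> mid_spec i.2.1.1 i.2.1.2 id b,
    i.1 = (true, false) -> i.2.1.1 != i.2.2 -> i.2.1.2 != i.2.2 -> i.2.1.1 != i.2.1.2 -> link_spec
      i.2.1.1 i.2.1.2 i.2.2 b &
    i.1 = (true, true) -> uniq (vs3 i.2) -> apex_spec i.2 b].
have ex i : exists b, spec i b.
  case: i => [[c1 c2] [[x y] z]]; rewrite /spec; case: c1; case: c2 => /=.
  - case: (boolP (uniq (vs3 (x, y, z)))) => um; last by exists (no_blocks H); split=> // _ h; case/negP: um.
    by have [b bP] := apex_blocks H um; exists b; split=> // _ _; exact: bP.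
  - case: (boolP [&& x != z, y != z & x != y]) => [/and3P[xz yz xy]|h]; last first.
      by exists (no_blocks H); split=> // _ a b c; case/negP: h; rewrite a b c.
    by have [b bP] := link_blocks H xz yz xy; exists b; split=> // _ _ _ _; exact: bP.
  - case: (boolP (x != y)) => xy; last by exists (no_blocks H); split=> // _ h; case/negP: xy.
    by have [|b bP] := @mid_blocks _ H x y id xy; [move=> w; rewrite !inE eqxx orbT | exists b;
      split=> // _ _; exact: bP].
  - case: (boolP (x != y)) => xy; last by exists (no_blocks H); split=> // _ h; case/negP: xy.
    by have [|b bP] := @mid_blocks _ H x y (fun=> x) xy; [move=> w; rewrite !inE eqxx | exists b;
      split=> // _ _; exact: bP].
have [b bP] := fin_all_exists ex.
have [|||f fc fP] := n0P V (edges H) I b => //; first exact: card_edge.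
  by rewrite !card_prod card_bool; apply: eq_leq; rewrite /=; ring.
exists f => //; split.
- move=> x y; have [<-|xy] := eqVneq x y; first by rewrite antisym0 //; apply: antisym_imbalance.
  rewrite imbalanceE //.
  have yx : y != x by rewrite eq_sym.
  have nE : nbrs H y x = nbrs H x y by apply/setP=> z; rewrite !inE tri_swap.
  have [/(_ erefl xy)[i1 k1 h1] _ _ _] := bP ((false, false), (x, y, x)).
  have [/(_ erefl yx)[i2 k2 h2] _ _ _] := bP ((false, false), (y, x, x)).
  have [_ /(_ erefl xy)[i3 k3 h3] _ _] := bP ((false, true), (x, y, x)).
  have := fP ((false, false), (x, y, x)); rewrite i1 k1 h1 /=.
  have := fP ((false, false), (y, x, x)); rewrite i2 k2 h2 /= nE.
  have := fP ((false, true), (x, y, x)); rewrite i3 k3 h3 /=.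
  rewrite /mid_count (card_edges_through H (fun e => f e == x) xy) (card_edges_through H (fun e => f e
    == y) yx) nE.
  have -> : [set z in nbrs H x y | f (tri y x z) == y] = [set z in nbrs H x y | f (tri x y z) == y].
    by apply/setP=> z; rewrite !inE (tri_swap x y).
  (* Only lower bounds are available. As the three counts add up to the codegree N, each being at
     least (N - n / D) / 3 forces each to be at most (N + 2 n / D) / 3, so two of them differ by at
     most n / D. *)
  have : #|[set z in nbrs H x y | f (tri x y z) == x]| + #|[set z in nbrs H x y | f (tri x y z) == y]| +
      #|[set z in nbrs H x y | f (tri x y z) == z]| = #|nbrs H x y|.
    rewrite -!sum1_card !(eq_bigl (fun z => (z \in nbrs H x y) && _) _ (fun z => in_set _ z)).
    rewrite !big_mkcondr -!big_split /=; apply: eq_bigr => z; rewrite inE => zE.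
    have := choicesP _ _ fc _ zE; have [_ yz xz] := card_tri (card_edge zE); rewrite /tri !inE.
    by case/orP=> [/orP[]|] /eqP ->;
      rewrite ?eqxx ?(negbTE xy) ?(negbTE yx) ?(negbTE yz) ?(negbTE xz) // !(eq_sym z) ?(negbTE yz)
        ?(negbTE xz).
  rewrite !expn1; move: (#|_|) (#|_|) (#|_|) (#|_|) => a c d e; lia.
- move=> m um; have [_ _ _ /(_ erefl um)[i k h]] := bP ((true, true), m).
  by have := fP ((true, true), m); rewrite i k h.
- move=> x x' y xy x'y xx'; have [_ _ /(_ erefl xy x'y xx')[i k h] _] := bP ((true, false), (x, x', y)).
  by have := fP ((true, false), (x, x', y)); rewrite i k h.
Qed.

(** The codegree condition is (2/3 + 1/K) n with denominators cleared, so that all bookkeeping is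
    done in [nat]. *)
Lemma eulerian_of_codegree (R : archiRealFieldType) K : 0 < K -> exists n0 : nat,
  forall (V : finType) (H : graph3 V), n0 <= #|V| -> vertex_divisible3 H ->
  (forall x y, x != y -> (2 * K + 3) * #|V| <= 3 * K * codegree H x y) -> eulerian H.
Proof.
move=> K0; have [C CP] := shift_decomposition.
(* With L = n / M, the ratio r / P = 2 M meets [n * P <= L * r], and P + r = (1 + 2 M) C B. So [M]
   gives 648 K L <= n and [D] gives 162 K (P + r + B) <= n, enough against 3 n / K possible apexes
   of which one in 27 is ready. *)
pose M := 648 * K; pose D := 162 * K * (1 + 2 * M) * C.+1.
have M0 : 0 < M by rewrite muln_gt0.
have D0 : 0 < D by rewrite !muln_gt0 K0.
have ME : M = 648 * K by [].
have DE : D = 162 * K * (1 + 2 * M) * C.+1 by [].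
clearbody D M.
have [n0 n0P] := quasirandom_mid R D0.
exists (n0 + D + M + 20) => V H; set n := #|V| => nV div codeg.
have [|f0 f0c [f0A f0B f0C]] := n0P V H; first by rewrite -/n; lia.
pose B := n %/ D; pose L := n %/ M; pose P := C * B; pose r := 2 * M * P.
have nb x y : x != y -> (2 * K + 3) * n <= 3 * K * #|nbrs H x y|.
  by move=> xy; rewrite -codegreeE //; apply: codeg.
have B0 : 0 < B by rewrite divn_gt0 //; lia.
have L0 : 0 < L by rewrite divn_gt0 //; lia.
have DB : D * B <= n by rewrite mulnC leq_divM.
have ML : M * L <= n by rewrite mulnC leq_divM.
have nL : n <= 2 * M * L.
  have : M <= M * L by rewrite leq_pmulr.
  have : n < M * L + M by rewrite {1}(divn_eq n M) mulnC ltn_add2l ltn_pmod.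
  by rewrite -mulnA mul2n -addnn => h1 h2; apply: leq_trans (ltnW h1) _; rewrite leq_add2l.
have small1 : 162 * K * (P + r) + 162 * K * B <= n.
  apply: leq_trans DB; rewrite /r /P DE; clear.
  move: (162 * K) (2 * M) => a m.
  have -> : a * (C * B + m * (C * B)) + a * B = a * ((1 + m) * C + 1) * B by ring.
  by rewrite leq_mul // -(mulnA a) leq_mul // mulnS addnC leq_add.
have KB : 162 * (K * B) <= n by move: small1; rewrite -!mulnA; apply: leq_trans; rewrite leq_addl.
have KPr : 162 * (K * (P + r)) <= n by move: small1; rewrite -!mulnA; apply: leq_trans; rewrite leq_addr.
have KL : 648 * (K * L) <= n by rewrite mulnA -ME.
have KB' : B <= K * B by rewrite leq_pmull.
have KL' : L <= K * L by rewrite leq_pmull.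
have KP' : P <= K * (P + r) by apply: leq_trans (leq_addr _ _) (leq_pmull _ K0).
have n20 : 20 <= #|V| by rewrite -/n; lia.
have anti : antisym (- imbalance H f0)%R.
  by move=> x y; rewrite !ffunE (antisym_imbalance H f0 x y).
have bB x y : (`|(- imbalance H f0)%R (x, y)| <= B%:Z)%R by rewrite ffunE normrN; apply: f0A.
have bd x : exists k : int, (dvg (- imbalance H f0) x = k * 3)%R.
  rewrite dvgN dvg_imbalance //; have /dvdnP[k ->] := div x.
  by exists (k%:Z - #|[set e in edges H | f0 e == x]|%:Z)%R; rewrite PoszM; ring.
have bp : exists c : int, (par (- imbalance H f0) = c * 2)%R.
  by have [c Ec] := par_imbalance f0c; exists (- c)%R; rewrite parN Ec mulNr.
have [ms [msE msU msL]] := CP V _ B n20 B0 anti bB bd bp.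
have nPLr : #|V| * P <= L * r.
  by rewrite /r mulnA (mulnC L) leq_mul2r nL orbT.
have good m : uniq (vs3 m) -> 3 * (P + 4 * L) + 3 * r < #|[set a | ready H m f0 a]|.
  move=> um; have := f0B m um; set g := #|[set a | _]|; rewrite -/n -/B => le.
  have [m1 m2 m3] : [/\ m.1.2 != m.2, m.2 != m.1.1 & m.1.1 != m.1.2].
    by move: um; rewrite /vs3 /= !inE !negb_or (eq_sym m.2) => /and3P[/andP[-> ->] -> _].
  have ae : apexes H m = nbrs H m.1.2 m.2 :&: nbrs H m.2 m.1.1 :&: nbrs H m.1.1 m.1.2.
    by apply/setP=> a; rewrite !inE /= andbT -andbA !(tri_rot a).
  have s1 := card_setI_ge (nbrs H m.1.2 m.2) (nbrs H m.2 m.1.1).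
  have s2 := card_setI_ge (nbrs H m.1.2 m.2 :&: nbrs H m.2 m.1.1) (nbrs H m.1.1 m.1.2).
  rewrite -ae -/n in s1 s2.
  (* Three sets of size at least (2/3 + 1/K) n have at least 3 n / K common elements. *)
  have n3 : 3 * n <= K * #|apexes H m|.
    have := nb _ _ m1; have := nb _ _ m2; have := nb _ _ m3.
    move: s1 s2; move: #|apexes H m| #|nbrs H m.1.2 m.2| #|nbrs H m.2 m.1.1| #|nbrs H m.1.1 m.1.2| => a b c d.
    move: #|_| => e s1 s2 h1 h2 h3.
    have : 3 * K * (b + c + d) <= 3 * K * (a + 2 * n) by rewrite leq_mul2l; apply/orP; right; lia.
    lia.
  have {}le : K * #|apexes H m| <= 27 * (K * g) + K * B.
    by rewrite mulnCA -mulnDr leq_mul2l le orbT.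
  rewrite ltnNge; apply/negP=> gle.
  have : K * g <= K * (3 * (P + 4 * L) + 3 * r) by rewrite leq_mul2l gle orbT.
  rewrite !mulnDr !(mulnCA K) -mulnDr in KPr *; lia.
have [hs [f [hsE hsR [fc ff0] fb]]] := realize_shifts f0c L0 nPLr msU msL good.
have f0' : imbalance H f = 0%R by rewrite fb -msE addrN.
apply: (@balanced_eulerian V H f).
- exact/choicesP.
- exact: imbalance0_balanced.
move=> x x' y xy x'y xx'.
have := f0C x x' y xy x'y xx'; set S := [set z in _ | _]; rewrite -/n -/B => le.
pose U1 := [set z | tri z x y \in used hs]; pose U2 := [set z | tri z x' y \in used hs].
have u1 : #|U1| <= P + 4 * L by apply: (card_used_through hsR) => //; rewrite hsE msL.
have u2 : #|U2| <= P + 4 * L by apply: (card_used_through hsR) => //; rewrite hsE msL.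
have s1 := card_setI_ge (nbrs H x y) (nbrs H x' y); rewrite -/n in s1.
have nS : n <= 3 * #|nbrs H x y :&: nbrs H x' y|.
  have := nb _ _ xy; have := nb _ _ x'y; move: s1.
  move: #|nbrs H x y| #|nbrs H x' y| #|_ :&: _| => a b c s1 h1 h2.
  have : 3 * K * (a + b) <= 3 * K * (c + n) by rewrite leq_mul2l s1 orbT.
  have : n * K <= 3 * c * K -> n <= 3 * c by rewrite leq_pmul2r.
  lia.
(* The two pairs have at least n / 3 common neighbours, of which about one in 9 links them under
   [f0]; some link avoids all changed edges. *)
have /subsetPn[z] : ~~ (S \subset U1 :|: U2).
  apply/negP=> /subset_leq_card; rewrite leqNgt => /negP[].
  by apply: leq_ltn_trans (leq_card_setU _ _) _; lia.
rewrite in_setU negb_or !(in_set (fun z => tri z _ _ \in _)) => + /andP[z1 z2].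
rewrite !inE => /andP[/andP[e1 e2] /andP[/eqP f1 /eqP f2]].
exists z; split=> //; rewrite ff0 // ?f1 ?f2 //; by rewrite tri_rot.
Qed.

Local Open Scope ring_scope.

Theorem corollary1p3 (R : realType) (eps : R) (heps : 0 < eps) :
  exists n0 : nat, forall (V : finType) (H : graph3 V),
    (n0 <= #|V|)%N ->
    vertex_divisible3 H ->
    (2 / 3 + eps) * #|V|%:R <= (min_codegree H)%:R ->
    eulerian H.
Proof.
(* Then 1 / K <= eps; the successor makes [K] visibly positive. *)
pose K := (Num.bound eps^-1).+1.
have Ke : 1 <= K%:R * eps.
  have := archi_boundP (ltW (_ : 0 < eps^-1)); rewrite invr_gt0 heps => /(_ isT) lt.
  rewrite -ler_pdivrMr // mul1r; apply: le_trans (ltW lt) _; rewrite ler_nat; exact: leqnSn.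
have [n0 n0P] := eulerian_of_codegree R (isT : (0 < K)%N).
exists n0 => V H nV dv le; apply: n0P => // x y xy.
rewrite -(ler_nat R) !natrM natrD natrM.
have {}le : (2 / 3 + eps) * #|V|%:R <= (codegree H x y)%:R.
  by apply: le_trans le _; rewrite ler_nat; apply: min_codegree_le.
have K0 : 0 <= K%:R :> R by [].
have n0' : 0 <= #|V|%:R :> R by [].
have := ler_wpM2l (_ : 0 <= 3 * K%:R) le; rewrite mulr_ge0 // => /(_ isT); apply: le_trans.
have := ler_wpM2r n0' Ke.
by move: (K%:R : R) (#|V|%:R : R) => k v; lra.
Qed.
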